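(* The classes $\mathtt{HCEGIS}$ and $\mathtt{CEGIS}$ are incomparable: $\mathtt{HCEGIS}\not\subseteq\mathtt{CEGIS}$ and $\mathtt{CEGIS}\not\subseteq\mathtt{HCEGIS}$ (in particular $\mathtt{HCEGIS}\neq\mathtt{CEGIS}$). Here $\mathtt{CEGIS}$ (resp. $\mathtt{HCEGIS}$) denotes the class of indexed families of languages $\mathscr{L}$ for which there exists a CEGIS engine (resp. HCEGIS engine) that identifies $\mathscr{L}$.
   Context: Languages are subsets of $\mathbb{N}$, ordered by the natural order of $\mathbb{N}$; $\overline{L}=\mathbb{N}\setminus L$. An indexed family of languages is a sequence $\mathscr{L}=L_0,L_1,\ldots$ of non-empty recursive languages for which there is a total recursive function $\mathtt{TEMPLATE}$ with $\mathtt{TEMPLATE}(i,n)=1$ if $n\in L_i$ and $0$ otherwise; the program $P_i$ is $n\mapsto\mathtt{TEMPLATE}(i,n)$, $\mathscr{P}=\{P_0,P_1,\ldots\}$, and $L(P_i)=L_i$. A sequence is a map $\sigma:\mathbb{N}\to\mathbb{N}\cup\{\bot\}$; $\sigma[k]$ is its prefix of length $k$, $\sigma(k)$ its $k$-th element, $\sigma_0$ the empty sequence, $\mathtt{SMPL}(\sigma)=\mathrm{range}(\sigma)\setminus\{\bot\}$. A trace for $L$ is a sequence $\tau$ with $\mathtt{SMPL}(\tau)=L$. A verifier $\mathtt{CHECK}_L$ is a (non-deterministic) map from $\mathscr{L}$ to $\mathbb{N}\cup\{\bot\}$ with $\mathtt{CHECK}_L(L_i)=\bot$ iff $L_i\subseteq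 L$ and otherwise $\mathtt{CHECK}_L(L_i)\in L_i\cap\overline{L}$. A history-bounded verifier $\mathtt{HCHECK}_L$ maps a language $L_i\in\mathscr{L}$ and a trace prefix $\tau[n]$ to $\mathbb{N}\cup\{\bot\}$: $\mathtt{HCHECK}_L(L_i,\tau[n])=m$ for some $m\in\overline{L}\cap L_i$ with $m<\tau(j)$ for some $j\le n$, if such $m$ exists, and $\mathtt{HCHECK}_L(L_i,\tau[n])=\bot$ otherwise. A CEGIS engine is given by a recursive $F:\mathscr{P}\times\mathbb{N}\times\mathbb{N}\to\mathscr{P}$ (counterexample argument may be $\bot$) and initial program $P_0$: $T(\sigma_0,\sigma_0)=P_0$, $T(\tau[n],\mathtt{cex}[n])=F(T(\tau[n-1],\mathtt{cex}[n-1]),\tau(n),\mathtt{cex}(n))$, where $\tau$ is a trace of the target language $L$ and $\mathtt{cex}(i)=\mathtt{CHECK}_L(L(T(\tau[i-1],\mathtt{cex}[i-1])))$. An HCEGIS engine is defined identically but with $\mathtt{cex}(i)=\mathtt{HCHECK}_L(L(T(\tau[i-1],\mathtt{cex}[i-1])),\tau[i-1])$. $T$ converges to $P_i$ on $(\tau,\mathtt{cex})$ if $T(\tau[n],\mathtt{cex}[n])=P_i$ for all sufficiently large $n$; $T$ identifies $L_i$ if it converges to $P_i$ for every trace $\tau$ of $L_i$ and every corresponding counterexample sequence; $T$ identifies $\mathscr{L}$ if it identifies every member. *)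

(* Defs.v *)
From Stdlib Require Import Arith Cantor.

(* Codes of mu-recursive functions on nat, with multi-argument functions
   encoded through the Cantor pairing [Cantor.to_nat] / [Cantor.of_nat]. *)
Inductive code : Type :=
| CZero : code
| CSucc : code
| CFst  : code
| CSnd  : code
| CPair : code -> code -> code
| CComp : code -> code -> code
| CRec  : code -> code -> code
| CMu   : code -> code.

Inductive eval : code -> nat -> nat -> Prop :=
| ev_zero x : eval CZero x 0
| ev_succ x : eval CSucc x (S x)
| ev_fst x : eval CFst x (fst (of_nat x))
| ev_snd x : eval CSnd x (snd (of_nat x))
| ev_pair f g x a b :
    eval f x a -> eval g x b -> eval (CPair f g) x (to_nat (a, b))
| ev_comp f g x y z :
    eval g x y -> eval f y z -> eval (CComp f g) x z
| ev_rec0 f g x y :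
    eval f x y -> eval (CRec f g) (to_nat (x, 0)) y
| ev_recS f g x n y z :
    eval (CRec f g) (to_nat (x, n)) y ->
    eval g (to_nat (x, to_nat (n, y))) z ->
    eval (CRec f g) (to_nat (x, S n)) z
| ev_mu f x n :
    eval f (to_nat (x, n)) 0 ->
    (forall m, m < n -> exists k, eval f (to_nat (x, m)) (S k)) ->
    eval (CMu f) x n.

Definition total_recursive (f : nat -> nat) : Prop :=
  exists c : code, forall x, eval c x (f x).

Definition decode_opt (n : nat) : option nat :=
  match n with 0 => None | S k => Some k end.

Definition language := nat -> Prop.

Record indexed_family : Type := {
  TEMPLATE : nat -> nat -> bool;
  TEMPLATE_recursive :
    total_recursive (fun x => let (i, n) := of_nat x in
                              if TEMPLATE i n then 1 else 0);
  TEMPLATE_nonempty : forall i, exists n, TEMPLATE i n = true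
}.

Definition Lang (LL : indexed_family) (i : nat) : language :=
  fun n => TEMPLATE LL i n = true.

(** Programs are represented by their indices i (P_i); P_j and P_i are the
    same program (the map n |-> TEMPLATE(i,n)) iff the templates agree. *)
Definition same_program (LL : indexed_family) (j i : nat) : Prop :=
  forall n, TEMPLATE LL j n = TEMPLATE LL i n.

Definition sequence := nat -> option nat.

Definition SMPL (s : sequence) : language := fun n => exists k, s k = Some n.

Definition is_trace (L : language) (tau : sequence) : Prop :=
  forall n, SMPL tau n <-> L n.

Record engine : Type := {
  F : nat -> option nat -> option nat -> nat;
      (* program index, trace element, counterexample (None = bot) *)
  F_recursive :
    total_recursive (fun x => let (p, r) := of_nat x in
                              let (t, c) := of_nat r in
                              F p (decode_opt t) (decode_opt c));
  P_init : nat
}.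

(** The hypothesis sequence: hyp 0 = initial program,
    hyp (n+1) = F (hyp n) (tau n) (cex n). Thus hyp n = T(tau[n-1], cex[n-1])
    is the conjecture after reading tau(0), ..., tau(n-1). *)
Fixpoint hyp (E : engine) (tau cex : sequence) (n : nat) : nat :=
  match n with
  | 0 => P_init E
  | S k => F E (hyp E tau cex k) (tau k) (cex k)
  end.

Definition CHECK_ok (LL : indexed_family) (L : language) (h : nat)
    (c : option nat) : Prop :=
  match c with
  | None => forall m, Lang LL h m -> L m
  | Some m => Lang LL h m /\ ~ L m
  end.

Definition hcex_candidate (LL : indexed_family) (L : language) (h : nat)
    (tau : sequence) (n m : nat) : Prop :=
  Lang LL h m /\ ~ L m /\
  exists j t, j < n /\ tau j = Some t /\ m < t.

Definition HCHECK_ok (LL : indexed_family) (L : language) (h : nat)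
    (tau : sequence) (n : nat) (c : option nat) : Prop :=
  match c with
  | None => ~ exists m, hcex_candidate LL L h tau n m
  | Some m => hcex_candidate LL L h tau n m
  end.

Definition converges_to (LL : indexed_family) (E : engine)
    (tau cex : sequence) (i : nat) : Prop :=
  exists N, forall n, N <= n -> same_program LL (hyp E tau cex n) i.

(** CEGIS identification: for every trace of L_i and every counterexample
    sequence produced by (a non-deterministic) CHECK_{L_i}. *)
Definition CEGIS_identifies (LL : indexed_family) (E : engine) (i : nat) : Prop :=
  forall tau cex : sequence,
    is_trace (Lang LL i) tau ->
    (forall n, CHECK_ok LL (Lang LL i) (hyp E tau cex n) (cex n)) ->
    converges_to LL E tau cex i.

Definition HCEGIS_identifies (LL : indexed_family) (E : engine) (i : nat) : Prop :=
  forall tau cex : sequence,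
    is_trace (Lang LL i) tau ->
    (forall n, HCHECK_ok LL (Lang LL i) (hyp E tau cex n) tau n (cex n)) ->
    converges_to LL E tau cex i.

Definition CEGIS (LL : indexed_family) : Prop :=
  exists E : engine, forall i, CEGIS_identifies LL E i.

Definition HCEGIS (LL : indexed_family) : Prop :=
  exists E : engine, forall i, HCEGIS_identifies LL E i.

(* Main.v *)
Require Import Defs.
From Stdlib Require Import Arith Cantor Lia Bool List Classical ClassicalEpsilon.
Import ListNotations.

(** CEGIS is not contained in HCEGIS: take [nat] and its finite initial segments.  A history-bounded verifier
    never answers on them, so that identification would be identification from positive data, which
    Gold's argument excludes; an unrestricted counterexample [m] allows the engine, starting from [nat],
    to shrink its guess to [{0, .., m - 1}] until it is exact.

    HCEGIS is not contained in CEGIS: an engine remembers only its current program, and a program that has a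
    unique index must not be left while the data and the verifier agree with it.  In [probe_family],
    with [d] coding [(i, c, v)], the infinite languages [T1 i] and [T2 d] have to be visited by every engine,
    which then forgets what it has seen.  When the engine is at [T1 i] it cannot know any more whether
    [A i c] has been presented; the counterexample [A i v] makes it leave.  Then some [X d x] is
    presented, and it must go on to [T2 d], since [A i c] may have been presented.  There it gets the counterexample
    [A i c], which bounds nothing, and has forgotten [x].  The first [L d s] conjectured afterwards
    does not depend on [x], is consistent with everything that follows, and is wrong if [x] is not in [s].
    All other programs are refuted by elements private to them.  A history-bounded
    verifier cannot do that to [M r d s]: its private elements are too large, so that the program
    tests for [A i c] while [s] still records the data. *)

(** * Closure properties of recursive functions *)

Lemma total_recursive_ext (f g : nat -> nat) :
  (forall x, f x = g x) -> total_recursive f -> total_recursive g.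
Proof. intros e [c hc]. exists c. intro x. rewrite <- e. apply hc. Qed.

Lemma total_recursive_succ : total_recursive S.
Proof. exists CSucc. apply ev_succ. Qed.

Lemma total_recursive_fst : total_recursive (fun x => fst (of_nat x)).
Proof. exists CFst. apply ev_fst. Qed.

Lemma total_recursive_snd : total_recursive (fun x => snd (of_nat x)).
Proof. exists CSnd. apply ev_snd. Qed.

Lemma total_recursive_comp (f g : nat -> nat) :
  total_recursive f -> total_recursive g -> total_recursive (fun x => f (g x)).
Proof.
  intros [c hc] [d hd]. exists (CComp c d). intro x.
  apply ev_comp with (g x); [apply hd | apply hc].
Qed.

Lemma total_recursive_pair (f g : nat -> nat) :
  total_recursive f -> total_recursive g -> total_recursive (fun x => to_nat (f x, g x)).
Proof. intros [c hc] [d hd]. exists (CPair c d). intro x. apply ev_pair; auto. Qed.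

Lemma total_recursive_id : total_recursive (fun x => x).
Proof.
  apply total_recursive_ext with (2 := total_recursive_pair _ _ total_recursive_fst total_recursive_snd).
  intro x. cbn beta. rewrite <- surjective_pairing. apply cancel_to_of.
Qed.

Lemma total_recursive_const (n : nat) : total_recursive (fun _ => n).
Proof.
  induction n as [|n IH].
  - exists CZero. apply ev_zero.
  - apply (total_recursive_comp S (fun _ => n)); [apply total_recursive_succ | exact IH].
Qed.

Lemma total_recursive_S (f : nat -> nat) :
  total_recursive f -> total_recursive (fun x => S (f x)).
Proof. apply total_recursive_comp, total_recursive_succ. Qed.

Lemma total_recursive_fst_of (f : nat -> nat) :
  total_recursive f -> total_recursive (fun x => fst (of_nat (f x))).
Proof. apply (total_recursive_comp (fun x => fst (of_nat x))), total_recursive_fst. Qed.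

Lemma total_recursive_snd_of (f : nat -> nat) :
  total_recursive f -> total_recursive (fun x => snd (of_nat (f x))).
Proof. apply (total_recursive_comp (fun x => snd (of_nat x))), total_recursive_snd. Qed.

(** The step function reads its parameter, counter and previous value from one number, nested as
    [CRec] passes them on. *)
Lemma total_recursive_natrec (b n : nat -> nat) (g : nat -> nat -> nat -> nat) :
  total_recursive b ->
  total_recursive (fun z => g (fst (of_nat z)) (fst (of_nat (snd (of_nat z))))
                              (snd (of_nat (snd (of_nat z))))) ->
  total_recursive n ->
  total_recursive (fun x => nat_rect (fun _ => nat) (b x) (g x) (n x)).
Proof.
  intros [c hc] [d hd] hn.
  assert (H : total_recursive (fun z => nat_rect (fun _ => nat) (b (fst (of_nat z)))
                                          (g (fst (of_nat z))) (snd (of_nat z)))).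
  { exists (CRec c d). intro z. rewrite <- (cancel_to_of z) at 1.
    destruct (of_nat z) as [x m]. cbn [fst snd].
    induction m as [|m IH]; cbn [nat_rect].
    - apply ev_rec0, hc.
    - eapply ev_recS; [exact IH|].
      specialize (hd (to_nat (x, to_nat (m, nat_rect (fun _ => nat) (b x) (g x) m)))).
      rewrite !cancel_of_to in hd. cbn [fst snd] in hd. rewrite !cancel_of_to in hd. exact hd. }
  apply total_recursive_ext with
    (2 := total_recursive_comp _ _ H (total_recursive_pair _ _ total_recursive_id hn)).
  intro x. cbn beta. rewrite cancel_of_to. reflexivity.
Qed.

Lemma total_recursive_case (n a : nat -> nat) (b : nat -> nat -> nat) :
  total_recursive n -> total_recursive a ->
  total_recursive (fun z => b (fst (of_nat z)) (snd (of_nat z))) ->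
  total_recursive (fun x => match n x with 0 => a x | S m => b x m end).
Proof.
  intros hn ha hb.
  apply total_recursive_ext with
    (f := fun x => nat_rect (fun _ => nat) (a x) (fun m _ => b x m) (n x)).
  { intro x. destruct (n x); reflexivity. }
  apply (total_recursive_natrec a n (fun x m _ => b x m)); auto.
  apply total_recursive_ext with
    (2 := total_recursive_comp _ _ hb
            (total_recursive_pair _ _ total_recursive_fst
               (total_recursive_fst_of _ total_recursive_snd))).
  intro x. cbn beta. rewrite cancel_of_to. reflexivity.
Qed.

Lemma total_recursive_pred (f : nat -> nat) :
  total_recursive f -> total_recursive (fun x => pred (f x)).
Proof.
  intro hf.
  apply total_recursive_ext with (f := fun x => match f x with 0 => 0 | S m => m end).
  { intro x. destruct (f x); reflexivity. }
  apply (total_recursive_case f (fun _ => 0) (fun _ m => m));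
    auto using total_recursive_const, total_recursive_snd.
Qed.

Lemma total_recursive_add (f g : nat -> nat) :
  total_recursive f -> total_recursive g -> total_recursive (fun x => f x + g x).
Proof.
  intros hf hg.
  apply total_recursive_ext with (f := fun x => nat_rect (fun _ => nat) (f x) (fun _ y => S y) (g x)).
  { intro x. induction (g x) as [|m IH]; cbn [nat_rect]; lia. }
  apply (total_recursive_natrec f g (fun _ _ y => S y)); auto.
  apply total_recursive_S, total_recursive_snd_of, total_recursive_snd.
Qed.

Lemma total_recursive_sub (f g : nat -> nat) :
  total_recursive f -> total_recursive g -> total_recursive (fun x => f x - g x).
Proof.
  intros hf hg.
  apply total_recursive_ext with (f := fun x => nat_rect (fun _ => nat) (f x) (fun _ y => pred y) (g x)).
  { intro x. induction (g x) as [|m IH]; cbn [nat_rect]; lia. }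
  apply (total_recursive_natrec f g (fun _ _ y => pred y)); auto.
  apply total_recursive_pred, total_recursive_snd_of, total_recursive_snd.
Qed.

(** * Recursive predicates and bit operations *)

Definition decidable_recursive (f : nat -> bool) : Prop :=
  total_recursive (fun x => if f x then 1 else 0).

Lemma total_recursive_if (f : nat -> bool) (a b : nat -> nat) :
  decidable_recursive f -> total_recursive a -> total_recursive b ->
  total_recursive (fun x => if f x then a x else b x).
Proof.
  intros hf ha hb.
  apply total_recursive_ext with
    (f := fun x => match (if f x then 1 else 0) with 0 => b x | S _ => a x end).
  { intro x. destruct (f x); reflexivity. }
  apply (total_recursive_case _ b (fun x _ => a x)); auto.
  apply (total_recursive_comp a); auto using total_recursive_fst.
Qed.

Lemma decidable_recursive_if (f a b : nat -> bool) :
  decidable_recursive f -> decidable_recursive a -> decidable_recursive b ->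
  decidable_recursive (fun x => if f x then a x else b x).
Proof.
  intros hf ha hb.
  apply total_recursive_ext with (2 := total_recursive_if f _ _ hf ha hb).
  intro x. destruct (f x); reflexivity.
Qed.

Lemma decidable_recursive_false : decidable_recursive (fun _ => false).
Proof. apply (total_recursive_const 0). Qed.

Lemma decidable_recursive_true : decidable_recursive (fun _ => true).
Proof. apply (total_recursive_const 1). Qed.

Lemma decidable_recursive_andb (f g : nat -> bool) :
  decidable_recursive f -> decidable_recursive g -> decidable_recursive (fun x => f x && g x).
Proof. intros hf hg. apply decidable_recursive_if; auto using decidable_recursive_false. Qed.

Lemma decidable_recursive_orb (f g : nat -> bool) :
  decidable_recursive f -> decidable_recursive g -> decidable_recursive (fun x => f x || g x).
Proof. intros hf hg. apply decidable_recursive_if; auto using decidable_recursive_true. Qed.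

Lemma decidable_recursive_negb (f : nat -> bool) :
  decidable_recursive f -> decidable_recursive (fun x => negb (f x)).
Proof.
  intros hf. apply (decidable_recursive_if f (fun _ => false) (fun _ => true));
    auto using decidable_recursive_true, decidable_recursive_false.
Qed.

Lemma decidable_recursive_leb (f g : nat -> nat) :
  total_recursive f -> total_recursive g -> decidable_recursive (fun x => f x <=? g x).
Proof.
  intros hf hg.
  apply total_recursive_ext with (f := fun x => 1 - (f x - g x)).
  { intro x. destruct (Nat.leb_spec (f x) (g x)); lia. }
  auto using total_recursive_sub, total_recursive_const.
Qed.

Lemma decidable_recursive_ltb (f g : nat -> nat) :
  total_recursive f -> total_recursive g -> decidable_recursive (fun x => f x <? g x).
Proof.
  intros hf hg. apply (decidable_recursive_leb (fun x => S (f x)));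
    auto using total_recursive_S.
Qed.

Lemma decidable_recursive_eqb (f g : nat -> nat) :
  total_recursive f -> total_recursive g -> decidable_recursive (fun x => f x =? g x).
Proof.
  intros hf hg.
  apply total_recursive_ext with (f := fun x => 1 - ((f x - g x) + (g x - f x))).
  { intro x. destruct (Nat.eqb_spec (f x) (g x)); lia. }
  auto using total_recursive_sub, total_recursive_add, total_recursive_const.
Qed.

Lemma decidable_recursive_odd (f : nat -> nat) :
  total_recursive f -> decidable_recursive (fun x => Nat.odd (f x)).
Proof.
  intros hf.
  apply total_recursive_ext with (f := fun x => nat_rect (fun _ => nat) 0 (fun _ y => 1 - y) (f x)).
  { intro x. induction (f x) as [|m IH]; [reflexivity|].
    cbn [nat_rect]. rewrite IH, Nat.odd_succ, <- Nat.negb_odd. destruct (Nat.odd m); reflexivity. }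
  apply (total_recursive_natrec (fun _ => 0) f (fun _ _ y => 1 - y));
    auto using total_recursive_const.
  apply total_recursive_sub; auto using total_recursive_const, total_recursive_snd_of, total_recursive_snd.
Qed.

Lemma div2_succ (n : nat) : Nat.div2 (S n) = Nat.div2 n + (if Nat.odd n then 1 else 0).
Proof.
  assert (H := Nat.div2_odd n). assert (H' := Nat.div2_odd (S n)).
  rewrite Nat.odd_succ, <- Nat.negb_odd in H'. unfold Nat.b2n in *.
  destruct (Nat.odd n); cbn [negb] in *; lia.
Qed.

Lemma total_recursive_div2 (f : nat -> nat) :
  total_recursive f -> total_recursive (fun x => Nat.div2 (f x)).
Proof.
  intros hf.
  apply total_recursive_ext with
    (f := fun x => nat_rect (fun _ => nat) 0 (fun m y => y + (if Nat.odd m then 1 else 0)) (f x)).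
  { intro x. induction (f x) as [|m IH]; [reflexivity|].
    cbn [nat_rect]. now rewrite IH, div2_succ. }
  apply (total_recursive_natrec (fun _ => 0) f (fun _ m y => y + (if Nat.odd m then 1 else 0)));
    auto using total_recursive_const.
  apply total_recursive_add.
  - auto using total_recursive_snd_of, total_recursive_snd.
  - apply decidable_recursive_odd. auto using total_recursive_fst_of, total_recursive_snd.
Qed.

Lemma decidable_recursive_testbit (f g : nat -> nat) :
  total_recursive f -> total_recursive g -> decidable_recursive (fun x => Nat.testbit (f x) (g x)).
Proof.
  intros hf hg.
  apply total_recursive_ext with
    (f := fun x => if Nat.odd (nat_rect (fun _ => nat) (f x) (fun _ y => Nat.div2 y) (g x)) then 1 else 0).
  { intro x. f_equal.
    assert (H : forall n a, Nat.odd (nat_rect (fun _ => nat) a (fun _ y => Nat.div2 y) n) = Nat.testbit a n).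
    { induction n as [|n IH]; intro a; [reflexivity|].
      cbn [Nat.testbit]. rewrite <- IH. f_equal.
      clear IH. induction n as [|n IH]; [reflexivity|]. cbn [nat_rect] in *. now rewrite IH. }
    now rewrite H. }
  apply decidable_recursive_odd.
  apply (total_recursive_natrec f g (fun _ _ y => Nat.div2 y)); auto.
  auto using total_recursive_div2, total_recursive_snd_of, total_recursive_snd.
Qed.

Lemma total_recursive_pow2 (f : nat -> nat) :
  total_recursive f -> total_recursive (fun x => 2 ^ f x).
Proof.
  intros hf.
  apply total_recursive_ext with (f := fun x => nat_rect (fun _ => nat) 1 (fun _ y => y + y) (f x)).
  { intro x. induction (f x) as [|m IH]; [reflexivity|].
    cbn [nat_rect]. rewrite IH. cbn [Nat.pow]. lia. }
  apply (total_recursive_natrec (fun _ => 1) f (fun _ _ y => y + y));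
    auto using total_recursive_const.
  apply total_recursive_add; auto using total_recursive_snd_of, total_recursive_snd.
Qed.

Ltac prove_recursive :=
  lazymatch goal with
  | |- total_recursive (fun x => x) => apply total_recursive_id
  | |- total_recursive (fun x => fst (of_nat (@?f x))) =>
      apply (total_recursive_fst_of f); prove_recursive
  | |- total_recursive (fun x => snd (of_nat (@?f x))) =>
      apply (total_recursive_snd_of f); prove_recursive
  | |- total_recursive (fun x => to_nat (@?f x, @?g x)) =>
      apply (total_recursive_pair f g); prove_recursive
  | |- total_recursive (fun x => pred (@?f x)) =>
      apply (total_recursive_pred f); prove_recursive
  | |- total_recursive (fun x => @?f x + @?g x) =>
      apply (total_recursive_add f g); prove_recursive
  | |- total_recursive (fun x => 2 ^ @?f x) =>
      apply (total_recursive_pow2 f); prove_recursive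
  | |- total_recursive (fun x => if @?f x then @?g x else @?h x) =>
      apply (total_recursive_if f g h); prove_recursive
  | |- total_recursive (fun _ => ?n) => apply total_recursive_const
  | |- decidable_recursive (fun x => @?f x && @?g x) =>
      apply (decidable_recursive_andb f g); prove_recursive
  | |- decidable_recursive (fun x => @?f x || @?g x) =>
      apply (decidable_recursive_orb f g); prove_recursive
  | |- decidable_recursive (fun x => negb (@?f x)) =>
      apply (decidable_recursive_negb f); prove_recursive
  | |- decidable_recursive (fun x => @?f x =? @?g x) =>
      apply (decidable_recursive_eqb f g); prove_recursive
  | |- decidable_recursive (fun x => @?f x <? @?g x) =>
      apply (decidable_recursive_ltb f g); prove_recursive
  | |- decidable_recursive (fun x => Nat.testbit (@?f x) (@?g x)) =>
      apply (decidable_recursive_testbit f g); prove_recursive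
  | |- decidable_recursive (fun x => if @?f x then @?g x else @?h x) =>
      apply (decidable_recursive_if f g h); prove_recursive
  | _ => assumption
  end.

(** * Initial segments *)

Lemma initial_segments_recursive :
  total_recursive (fun x => let (i, n) := of_nat x in if (i =? 0) || (n <? i) then 1 else 0).
Proof.
  apply total_recursive_ext with
    (f := fun x => if (fst (of_nat x) =? 0) || (snd (of_nat x) <? fst (of_nat x)) then 1 else 0).
  { intro x. destruct (of_nat x); reflexivity. }
  change (decidable_recursive (fun x => (fst (of_nat x) =? 0) || (snd (of_nat x) <? fst (of_nat x)))).
  prove_recursive.
Qed.

Lemma initial_segments_nonempty (i : nat) : exists n, (i =? 0) || (n <? i) = true.
Proof. exists 0. now destruct i. Qed.

Definition initial_segments : indexed_family :=
  {| TEMPLATE := fun i n => (i =? 0) || (n <? i);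
     TEMPLATE_recursive := initial_segments_recursive;
     TEMPLATE_nonempty := initial_segments_nonempty |}.

Lemma initial_segments_lang (i n : nat) : Lang initial_segments i n <-> i = 0 \/ n < i.
Proof. unfold Lang; cbn [TEMPLATE initial_segments]. now rewrite orb_true_iff, Nat.eqb_eq, Nat.ltb_lt. Qed.

Lemma initial_segments_inj (i j : nat) : same_program initial_segments i j -> i = j.
Proof.
  intro H. assert (L : forall n, (i = 0 \/ n < i) <-> (j = 0 \/ n < j)).
  { intro n. rewrite <- !initial_segments_lang. unfold Lang. now rewrite (H n). }
  assert (Hi := L i). assert (Hj := L j). lia.
Qed.

Lemma shrink_recursive :
  total_recursive (fun x => let (p, r) := of_nat x in let (t, c) := of_nat r in
    (fun p (_ c : option nat) => match c with None => p | Some m => m end)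
      p (decode_opt t) (decode_opt c)).
Proof.
  apply total_recursive_ext with
    (f := fun x => if snd (of_nat (snd (of_nat x))) =? 0 then fst (of_nat x)
                   else pred (snd (of_nat (snd (of_nat x))))).
  { intro x. destruct (of_nat x) as [p r]. cbn [fst snd].
    destruct (of_nat r) as [t c]. destruct c; reflexivity. }
  prove_recursive.
Qed.

Definition shrink_engine : engine :=
  {| F := fun p _ c => match c with None => p | Some m => m end;
     F_recursive := shrink_recursive;
     P_init := 0 |}.

Lemma nonincreasing_eventually_constant (f : nat -> nat) :
  (forall n, f (S n) <= f n) -> exists N, forall n, N <= n -> f n = f N.
Proof.
  intro mono.
  assert (H : forall b N0, f N0 <= b -> exists N, forall n, N <= n -> f n = f N).
  { induction b as [|b IH]; intros N0 hb.
    - exists N0. intros n hn. induction hn as [|m _ IHm]; [reflexivity|].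
      specialize (mono m). lia.
    - destruct (Nat.eq_dec (f N0) (S b)) as [e|]; [|apply (IH N0); lia].
      destruct (classic (exists n, N0 <= n /\ f n <= b)) as [[n [_ hn]]|no].
      + exact (IH n hn).
      + exists N0. intros n hn. assert (f n <= f N0).
        { clear -mono hn. induction hn as [|m _ IHm]; [lia|]. specialize (mono m). lia. }
        destruct (le_lt_dec (f n) b) as [l|]; [|lia].
        exfalso. apply no. now exists n. }
  exact (H (f 0) 0 (le_n _)).
Qed.

(* Index [0] stands for the whole of [nat], so [0] counts as larger than the target; from there on every
   counterexample [m] is at least the target's length, and [m] is the index of the next guess. *)
Lemma initial_segments_CEGIS : CEGIS initial_segments.
Proof.
  exists shrink_engine. intros i tau cex _ ok.
  set (h := hyp shrink_engine tau cex).
  (* The second alternative is a counterexample. The last two, silence at a guess properly inside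
     the target, are excluded by [inv] below: the guess starts at all of [nat] and never drops below
     the target. *)
  assert (step : forall n, h (S n) = h n /\ (h n = i \/ i <> 0 /\ i < h n) \/
            h (S n) <> 0 /\ i <= h (S n) /\ i <> 0 /\ (h n = 0 \/ h (S n) < h n) \/
            h (S n) = h n /\ h n <> 0 /\ h n < i \/ h (S n) = h n /\ h n <> 0 /\ i = 0).
  { intro n. specialize (ok n). fold (h n) in ok.
    change (h (S n)) with (match cex n with None => h n | Some m => m end).
    destruct (cex n) as [m|]; cbn in ok.
    - rewrite !initial_segments_lang in ok. lia.
    - assert (q := ok (h n)). assert (q' := ok i). assert (q0 := ok (pred (h n))).
      rewrite !initial_segments_lang in q, q', q0. lia. }
  assert (inv : forall n, h n = 0 \/ i <> 0 /\ i <= h n).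
  { induction n as [|n IH]; [now left|]. specialize (step n). lia. }
  assert (fin : exists N, forall n, N <= n -> h n = h N).
  { destruct (classic (exists N, h N <> 0)) as [[N hN]|no].
    - assert (nz : forall n, h (N + n) <> 0).
      { induction n as [|n IH]; [now rewrite Nat.add_0_r|]. rewrite Nat.add_succ_r.
        specialize (step (N + n)). lia. }
      destruct (nonincreasing_eventually_constant (fun n => h (N + n))) as [M hM].
      { intro n. cbn beta. rewrite Nat.add_succ_r. specialize (step (N + n)).
        specialize (nz n). lia. }
      exists (N + M). intros n hn. specialize (hM (n - N)). cbn beta in hM.
      replace (N + (n - N)) with n in hM by lia. apply hM. lia.
    - exists 0. intros n _. destruct (Nat.eq_dec (h n) 0) as [e|ne]; [exact e|].
      exfalso. apply no. now exists n. }
  destruct fin as [N hN]. exists N. intros n hn. fold (h n). rewrite (hN n hn).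
  assert (e : h N = i); [|now rewrite e].
  specialize (ok N). fold (h N) in ok. specialize (hN (S N) (Nat.le_succ_diag_r N)).
  change (h (S N)) with (match cex N with None => h N | Some m => m end) in hN.
  (* A counterexample would become the next guess and be smaller than the present one, or nonzero
     where the present one is [0]. Silence, tested at [i] and at the last element [pred (h N)] of
     the guess, forces equality. *)
  specialize (inv N). destruct (cex N) as [m|]; cbn in ok.
  - subst m. rewrite !initial_segments_lang in ok. lia.
  - assert (q' := ok i). rewrite !initial_segments_lang in q'.
    assert (q0 := ok (pred (h N))). rewrite !initial_segments_lang in q0. lia.
Qed.

(* No element outside an initial segment lies below one of its members: the verifier is silent. *)
Lemma initial_segments_silent (i : nat) (tau : sequence) (h n : nat) :
  is_trace (Lang initial_segments i) tau ->
  HCHECK_ok initial_segments (Lang initial_segments i) h tau n None.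
Proof.
  intros tr [m [_ [hm [j [t [_ [e lt]]]]]]]. apply hm.
  assert (ht : Lang initial_segments i t) by (apply tr; now exists j).
  rewrite initial_segments_lang in *. lia.
Qed.

(** * Gold's argument against identification from positive data *)

Section gold.
Variable E : engine.
Hypothesis identifies : forall i, HCEGIS_identifies initial_segments E i.

(* The adversary presents [k] until the engine conjectures [{0, .., k}], and then goes on to [k + 1]. *)
Fixpoint gold (n : nat) : nat * nat :=
  match n with
  | 0 => (P_init E, 0)
  | S n => let (p, k) := gold n in
           let p' := F E p (Some k) None in (p', if p' =? S k then S k else k)
  end.

Definition gold_trace : sequence := fun n => Some (snd (gold n)).

Lemma gold_hyp (n : nat) : hyp E gold_trace (fun _ => None) n = fst (gold n).
Proof.
  induction n as [|n IH]; [reflexivity|].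
  cbn [hyp]. rewrite IH. unfold gold_trace. cbn [gold]. now destruct (gold n).
Qed.

(** Silence is a legitimate answer throughout, and an index is determined by its language, so the
    index itself becomes constant. *)
Lemma gold_converges (i : nat) : is_trace (Lang initial_segments i) gold_trace ->
  exists N, forall n, N <= n -> fst (gold n) = i.
Proof.
  intro tr. destruct (identifies i gold_trace (fun _ => None) tr) as [N hN].
  { intro n. now apply initial_segments_silent with (1 := tr). }
  exists N. intros n hn. apply initial_segments_inj. rewrite <- gold_hyp. auto.
Qed.

Lemma gold_step (n : nat) :
  snd (gold (S n)) = snd (gold n) /\ fst (gold (S n)) <> S (snd (gold n)) \/
  snd (gold (S n)) = S (snd (gold n)) /\ fst (gold (S n)) = S (snd (gold n)).
Proof.
  cbn [gold]. destruct (gold n) as [p k]. cbn [fst snd].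
  destruct (Nat.eqb_spec (F E p (Some k) None) (S k)); auto.
Qed.

Lemma gold_mono (m n : nat) : m <= n -> snd (gold m) <= snd (gold n).
Proof. induction 1 as [|n _ IH]; [lia|]. destruct (gold_step n); lia. Qed.

(** If [S k] never came up, the data would be exactly the numbers up to [k]. The engine would then
    settle on the index [S k], which is the very event that releases [S k]. *)
Lemma gold_reaches (k : nat) : exists n, snd (gold n) = k.
Proof.
  induction k as [k IH] using lt_wf_ind.
  destruct k as [|k]; [now exists 0|].
  destruct (classic (exists n, snd (gold n) = S k)) as [|no]; [assumption|exfalso].
  assert (le : forall n, snd (gold n) <= k).
  { induction n as [|n IHn]; [cbn; lia|].
    destruct (gold_step n) as [[e _]|[e _]]; [lia|].
    destruct (Nat.eq_dec (snd (gold n)) k); [|lia]. exfalso. apply no. exists (S n). lia. }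
  destruct (gold_converges (S k)) as [N hN].
  { intro m. rewrite initial_segments_lang. split.
    - intros [j [= <-]]. specialize (le j). lia.
    - intros [|lt]; [discriminate|]. destruct (IH m lt) as [n hn].
      exists n. unfold gold_trace. now rewrite hn. }
  destruct (IH k) as [n hn]; [lia|].
  assert (e : snd (gold (max n N)) = k).
  { specialize (le (max n N)). assert (h := gold_mono n (max n N)). lia. }
  destruct (gold_step (max n N)) as [[_ ne]|[e' _]].
  - apply ne. rewrite e. apply hN. lia.
  - specialize (le (S (max n N))). lia.
Qed.

(** Every number is presented eventually, so the trace is one for index [0]. Convergence to [0]
    stops the releases, as each of them requires a nonzero conjecture. *)
Lemma gold_contradiction : False.
Proof.
  destruct (gold_converges 0) as [N hN].
  { intro m. rewrite initial_segments_lang. split; [now left|]. intros _.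
    destruct (gold_reaches m) as [n hn]. exists n. unfold gold_trace. now rewrite hn. }
  destruct (gold_reaches (S (snd (gold N)))) as [n hn].
  assert (stuck : forall m, snd (gold (N + m)) = snd (gold N)).
  { induction m as [|m IH]; [now rewrite Nat.add_0_r|]. rewrite Nat.add_succ_r.
    destruct (gold_step (N + m)) as [[e _]|[_ e]]; [lia|].
    rewrite hN in e by lia. discriminate. }
  destruct (le_lt_dec N n) as [l|l].
  - specialize (stuck (n - N)). replace (N + (n - N)) with n in stuck by lia. lia.
  - assert (h := gold_mono n N). lia.
Qed.
End gold.

Lemma initial_segments_not_HCEGIS : ~ HCEGIS initial_segments.
Proof. intros [E hE]. exact (gold_contradiction E hE). Qed.

(** * The probe family *)

Definition insert (s n : nat) : nat := if Nat.testbit s n then s else s + 2 ^ n.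

(** When bit [n] is clear, adding [2 ^ n] produces no carry, so that the sum is an exclusive or. *)
Lemma testbit_insert (s n m : nat) :
  Nat.testbit (insert s n) m = (m =? n) || Nat.testbit s m.
Proof.
  unfold insert. destruct (Nat.testbit s n) eqn:e.
  - destruct (Nat.eqb_spec m n) as [->|]; [exact e | reflexivity].
  - rewrite Nat.add_nocarry_lxor.
    + rewrite Nat.lxor_spec, Nat.pow2_bits_eqb, (Nat.eqb_sym n m).
      destruct (Nat.eqb_spec m n) as [->|]; [now rewrite e | now rewrite xorb_false_r].
    + apply Nat.bits_inj. intro k. rewrite Nat.land_spec, Nat.pow2_bits_eqb, Nat.bits_0.
      destruct (Nat.eqb_spec n k) as [<-|]; [now rewrite e | apply andb_false_r].
Qed.

Lemma testbit_lt (s n : nat) : Nat.testbit s n = true -> n < s.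
Proof.
  intro h. destruct (le_lt_dec s n) as [l|]; [|assumption].
  rewrite Nat.testbit_eqb, Nat.div_small in h; [discriminate|].
  apply Nat.le_lt_trans with n; [exact l | apply Nat.pow_gt_lin_r; lia].
Qed.

(* [s] encodes the finite set containing [0] and the [m + 1] such that bit [m] of [s] is set. *)
Definition in_set (s n : nat) : bool := (n =? 0) || Nat.testbit s (pred n).

Definition add_to_set (s n : nat) : nat := if n =? 0 then s else insert s (pred n).

Lemma in_set_add (s n m : nat) : in_set (add_to_set s n) m = (m =? n) || in_set s m.
Proof.
  unfold in_set, add_to_set. destruct n as [|n]; cbn [Nat.eqb pred].
  - now destruct m.
  - destruct m as [|m]; cbn [Nat.eqb pred orb]; [reflexivity | apply testbit_insert].
Qed.

(** The code of a set bounds its members. Hence codes mentioning [s] can be made to exceed the data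
    recorded in [s], and [S s] is always a fresh element. *)
Lemma in_set_le (s n : nat) : in_set s n = true -> n <= s.
Proof.
  unfold in_set. rewrite orb_true_iff, Nat.eqb_eq.
  intros [->|h]; [lia|]. apply testbit_lt in h. lia.
Qed.

Lemma in_set_inj (s t : nat) : (forall n, in_set s n = in_set t n) -> s = t.
Proof. intro h. apply Nat.bits_inj. intro n. exact (h (S n)). Qed.

Lemma in_set_zero (n : nat) : in_set 0 n = (n =? 0).
Proof. unfold in_set. now rewrite Nat.bits_0, orb_false_r. Qed.

Lemma to_nat_le (a b a' b' : nat) : a <= a' -> b <= b' -> to_nat (a, b) <= to_nat (a', b').
Proof.
  intros h h'. assert (e := to_nat_spec a b). assert (e' := to_nat_spec a' b'). nia.
Qed.

Lemma to_nat_lt (a b a' b' : nat) : a < a' -> b <= b' -> to_nat (a, b) < to_nat (a', b').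
Proof.
  intros h h'. assert (e := to_nat_spec a b). assert (e' := to_nat_spec a' b'). nia.
Qed.

(** * Elements, programs and their codes *)

Inductive elem : Type :=
| A (i n : nat)
| X (d n : nat)
| Q (r d s : nat).

Definition elem_of (e : nat) : elem :=
  let (k, p) := of_nat e in
  let (a, b) := of_nat p in
  match k with 0 => A a b | 1 => X a b | S (S r) => Q r a b end.

Definition of_elem (e : elem) : nat :=
  match e with
  | A i n => to_nat (0, to_nat (i, n))
  | X d n => to_nat (1, to_nat (d, n))
  | Q r d s => to_nat (S (S r), to_nat (d, s))
  end.

Lemma elem_ofK (e : elem) : elem_of (of_elem e) = e.
Proof. destruct e; unfold elem_of, of_elem; now rewrite !cancel_of_to. Qed.

Lemma of_elemK (e : nat) : of_elem (elem_of e) = e.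
Proof.
  unfold elem_of, of_elem. rewrite <- (cancel_to_of e) at 2.
  destruct (of_nat e) as [k p]. rewrite <- (cancel_to_of p) at 2.
  destruct (of_nat p) as [a b]. now destruct k as [|[|k]].
Qed.

Inductive prog : Type :=
| T1 (i : nat)
| T2 (d : nat)
| L (d s : nat)
| M (r d s : nat).

Definition prog_of (h : nat) : prog :=
  let (k, p) := of_nat h in
  match k with
  | 0 => T1 p
  | 1 => T2 p
  | 2 => L (fst (of_nat p)) (snd (of_nat p))
  | S (S (S r)) => M r (fst (of_nat p)) (snd (of_nat p))
  end.

Definition of_prog (g : prog) : nat :=
  match g with
  | T1 i => to_nat (0, i)
  | T2 d => to_nat (1, d)
  | L d s => to_nat (2, to_nat (d, s))
  | M r d s => to_nat (S (S (S r)), to_nat (d, s))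
  end.

Lemma prog_ofK (g : prog) : prog_of (of_prog g) = g.
Proof. destruct g; unfold prog_of, of_prog; now rewrite !cancel_of_to. Qed.

Lemma of_progK (h : nat) : of_prog (prog_of h) = h.
Proof.
  unfold prog_of, of_prog. rewrite <- (cancel_to_of h) at 2.
  destruct (of_nat h) as [k p].
  destruct k as [|[|[|k]]]; try reflexivity; now rewrite <- surjective_pairing, cancel_to_of.
Qed.

Definition mk_d (i c v : nat) : nat := to_nat (i, to_nat (c, v)).
Definition d_i (d : nat) : nat := fst (of_nat d).
Definition d_c (d : nat) : nat := fst (of_nat (snd (of_nat d))).
Definition d_v (d : nat) : nat := snd (of_nat (snd (of_nat d))).

Lemma mk_d_proj (i c v : nat) :
  d_i (mk_d i c v) = i /\ d_c (mk_d i c v) = c /\ d_v (mk_d i c v) = v.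
Proof.
  unfold d_i, d_c, d_v, mk_d. rewrite !cancel_of_to. cbn [fst snd].
  now rewrite !cancel_of_to.
Qed.

Lemma d_eq (d : nat) : d = mk_d (d_i d) (d_c d) (d_v d).
Proof.
  unfold mk_d, d_i, d_c, d_v. now rewrite <- !surjective_pairing, !cancel_to_of, <- surjective_pairing, cancel_to_of.
Qed.

(** On the [A] part with [c < v], the element [A i c] separates [T2 d] from [L d s], and [A i v]
    separates [T1 i] from both. The index [r] of [M] is padding: it leaves no mark on the
    language. *)
Definition member (g : prog) (e : elem) : bool :=
  match g, e with
  | T1 i, A j _ => j =? i
  | T2 d, A j n => (j =? d_i d) && ((n <? d_v d) || (n =? d_c d))
  | T2 d, X d' _ => d' =? d
  | L d s, A j n => (j =? d_i d) && ((n <? d_v d) && negb (n =? d_c d))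
  | L d s, X d' n => (d' =? d) && in_set s n
  | M _ d s, A j n => (j =? d_i d) && (n =? d_c d)
  | M _ d s, Q _ d' s' => (d' =? d) && (s' =? s)
  | _, _ => false
  end.

Lemma probe_recursive :
  total_recursive (fun x => let (h, e) := of_nat x in
                            if member (prog_of h) (elem_of e) then 1 else 0).
Proof.
  set (k := fun x => fst (of_nat (fst (of_nat x)))).
  set (p := fun x => snd (of_nat (fst (of_nat x)))).
  set (d := fun x => fst (of_nat (p x))).
  set (s := fun x => snd (of_nat (p x))).
  set (ke := fun x => fst (of_nat (snd (of_nat x)))).
  set (a := fun x => fst (of_nat (snd (of_nat (snd (of_nat x)))))).
  set (b := fun x => snd (of_nat (snd (of_nat (snd (of_nat x)))))).
  assert (hk : total_recursive k) by (unfold k; prove_recursive).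
  assert (hp : total_recursive p) by (unfold p; prove_recursive).
  assert (hd : total_recursive d) by (unfold d; prove_recursive).
  assert (hs : total_recursive s) by (unfold s; prove_recursive).
  assert (hke : total_recursive ke) by (unfold ke; prove_recursive).
  assert (ha : total_recursive a) by (unfold a; prove_recursive).
  assert (hb : total_recursive b) by (unfold b; prove_recursive).
  apply total_recursive_ext with (f := fun x =>
    if (if k x =? 0 then (ke x =? 0) && (a x =? p x)
        else if k x =? 1 then
          if ke x =? 0 then (a x =? d_i (p x)) && ((b x <? d_v (p x)) || (b x =? d_c (p x)))
          else (ke x =? 1) && (a x =? p x)
        else if k x =? 2 then
          if ke x =? 0 then (a x =? d_i (d x)) && ((b x <? d_v (d x)) && negb (b x =? d_c (d x)))
          else (ke x =? 1) && ((a x =? d x) && in_set (s x) (b x))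
        else
          if ke x =? 0 then (a x =? d_i (d x)) && (b x =? d_c (d x))
          else negb (ke x =? 1) && ((a x =? d x) && (b x =? s x)))
    then 1 else 0).
  { intro x. unfold d, s. unfold k, p, ke, a, b, prog_of, elem_of.
    destruct (of_nat x) as [h e]. cbn [fst snd].
    destruct (of_nat h) as [k' p']. destruct (of_nat e) as [ke' pe]. cbn [fst snd].
    destruct (of_nat pe) as [a' b']. cbn [fst snd].
    destruct k' as [|[|[|k']]]; destruct ke' as [|[|ke']]; reflexivity. }
  clearbody k p d s ke a b. unfold in_set, d_i, d_c, d_v.
  apply total_recursive_if; prove_recursive.
Qed.

Lemma probe_nonempty (h : nat) : exists n, member (prog_of h) (elem_of n) = true.
Proof.
  assert (H : exists e, member (prog_of h) e = true).
  { destruct (prog_of h) as [i|d|d s|r d s].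
    - exists (A i 0). apply Nat.eqb_refl.
    - exists (X d 0). apply Nat.eqb_refl.
    - exists (X d 0). cbn. now rewrite Nat.eqb_refl.
    - exists (Q 0 d s). cbn. now rewrite !Nat.eqb_refl. }
  destruct H as [e he]. exists (of_elem e). now rewrite elem_ofK.
Qed.

Definition probe_family : indexed_family :=
  {| TEMPLATE := fun h e => member (prog_of h) (elem_of e);
     TEMPLATE_recursive := probe_recursive;
     TEMPLATE_nonempty := probe_nonempty |}.

(** Conjecturing [M] asks whether the hidden [A i c] is in the target: a counterexample is taken as
    no, and leads to [L]. Silence means yes, but the target may still be [M] itself, so that only a
    further [X] leads on to [T2 d]. *)
Definition next (g : prog) (t : option elem) (c : option nat) : prog :=
  match g with
  | T1 i => match t with
            | None => T1 i
            | Some (A j _) => T1 j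
            | Some (X d n) => M 0 d (add_to_set 0 n)
            | Some (Q _ d s) => M 0 d s
            end
  | T2 d => T2 d
  | L d s => match t with Some (X _ n) => L d (add_to_set s n) | _ => L d s end
  | M r d s => match c, t with
               | Some _, Some (X _ n) => L d (add_to_set s n)
               | Some _, _ => L d s
               | None, Some (X _ _) => T2 d
               | None, _ => M r d s
               end
  end.

Definition probe_step (h : nat) (t c : option nat) : nat :=
  of_prog (next (prog_of h) (option_map elem_of t) c).

Lemma probe_step_recursive :
  total_recursive (fun x => let (p, r) := of_nat x in let (t, c) := of_nat r in
                            probe_step p (decode_opt t) (decode_opt c)).
Proof.
  set (h := fun x => fst (of_nat x)).
  set (t := fun x => fst (of_nat (snd (of_nat x)))).
  set (c := fun x => snd (of_nat (snd (of_nat x)))).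
  set (k := fun x => fst (of_nat (h x))).
  set (p := fun x => snd (of_nat (h x))).
  set (d := fun x => fst (of_nat (p x))).
  set (s := fun x => snd (of_nat (p x))).
  set (ke := fun x => fst (of_nat (pred (t x)))).
  set (a := fun x => fst (of_nat (snd (of_nat (pred (t x)))))).
  set (b := fun x => snd (of_nat (snd (of_nat (pred (t x)))))).
  assert (hh : total_recursive h) by (unfold h; prove_recursive).
  assert (ht : total_recursive t) by (unfold t; prove_recursive).
  assert (hc : total_recursive c) by (unfold c; prove_recursive).
  assert (hk : total_recursive k) by (unfold k; prove_recursive).
  assert (hp : total_recursive p) by (unfold p; prove_recursive).
  assert (hd : total_recursive d) by (unfold d; prove_recursive).
  assert (hs : total_recursive s) by (unfold s; prove_recursive).
  assert (hke : total_recursive ke) by (unfold ke; prove_recursive).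
  assert (ha : total_recursive a) by (unfold a; prove_recursive).
  assert (hb : total_recursive b) by (unfold b; prove_recursive).
  apply total_recursive_ext with (f := fun x =>
    if k x =? 0 then
      if t x =? 0 then h x
      else if ke x =? 0 then to_nat (0, a x)
      else if ke x =? 1 then to_nat (3, to_nat (a x, add_to_set 0 (b x)))
      else to_nat (3, to_nat (a x, b x))
    else if k x =? 1 then h x
    else if k x =? 2 then
      if t x =? 0 then h x
      else if ke x =? 1 then to_nat (2, to_nat (d x, add_to_set (s x) (b x))) else h x
    else if c x =? 0 then
      if t x =? 0 then h x
      else if ke x =? 1 then to_nat (1, d x) else h x
    else
      if t x =? 0 then to_nat (2, to_nat (d x, s x))
      else if ke x =? 1 then to_nat (2, to_nat (d x, add_to_set (s x) (b x)))
      else to_nat (2, to_nat (d x, s x))).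
  { intro x. unfold d, s. unfold k, p, ke, a, b. unfold h, t, c, probe_step.
    destruct (of_nat x) as [h' r']. cbn [fst snd].
    destruct (of_nat r') as [t' c']. cbn [fst snd].
    assert (eh := of_progK h'). unfold prog_of in *.
    destruct (of_nat h') as [k' p']. cbn [fst snd].
    destruct t' as [|t']; cbn [pred decode_opt option_map].
    (* Where the program is kept, the number returned is the old index [h'], which [eh] identifies
       with the code of its decoding. *)
    - destruct k' as [|[|[|k']]]; destruct c'; (reflexivity || exact (eq_sym eh)).
    - unfold elem_of. destruct (of_nat t') as [ke' pe]. cbn [fst snd].
      destruct (of_nat pe) as [a' b']. cbn [fst snd].
      destruct k' as [|[|[|k']]]; destruct ke' as [|[|ke']]; destruct c';
        (reflexivity || exact (eq_sym eh)). }
  clearbody h t c k p d s ke a b. unfold add_to_set, insert. prove_recursive.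
Qed.

Definition probe_engine : engine :=
  {| F := probe_step; F_recursive := probe_step_recursive; P_init := of_prog (T1 0) |}.

(** Once any [X d n] has been presented, a history-bounded verifier can no longer pass over a wrong
    [A i c]. *)
Lemma A_lt_X (d n : nat) : of_elem (A (d_i d) (d_c d)) < of_elem (X d n).
Proof.
  cbn [of_elem]. apply to_nat_lt; [lia|].
  apply Nat.le_trans with d.
  - rewrite (d_eq d) at 3. apply to_nat_le; [lia|].
    assert (h := to_nat_non_decreasing (d_c d) (d_v d)). lia.
  - assert (h := to_nat_non_decreasing d n). lia.
Qed.

(** With [X_le_Q], this keeps the private elements of [M] out of the verifier's reach when the
    target is [T2 d]. *)
Lemma A_le_Q (r d s n : nat) : n < d_v d \/ n = d_c d ->
  of_elem (A (d_i d) n) <= of_elem (Q r d s).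
Proof.
  intro hn. cbn [of_elem]. apply to_nat_le; [lia|].
  apply Nat.le_trans with d.
  - rewrite (d_eq d) at 2. apply to_nat_le; [lia|].
    assert (h := to_nat_non_decreasing (d_c d) (d_v d)). lia.
  - assert (h := to_nat_non_decreasing d s). lia.
Qed.

Lemma X_le_Q (r d s n : nat) : n <= s -> of_elem (X d n) <= of_elem (Q r d s).
Proof. intro hn. cbn [of_elem]. apply to_nat_le; [lia|]. apply to_nat_le; lia. Qed.

Ltac bool_hyps :=
  repeat match goal with
  | H : _ && _ = true |- _ => apply andb_true_iff in H; destruct H
  | H : (_ =? _) = true |- _ => apply Nat.eqb_eq in H; subst
  | H : (_ <? _) = true |- _ => apply Nat.ltb_lt in H
  | H : negb _ = true |- _ => apply negb_true_iff in H
  end.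

(** * Convergence of the probe engine against a history-bounded verifier *)

Section probe.
Variables (G : prog) (t : nat -> option elem) (cex : nat -> option nat) (g : nat -> prog).
Hypothesis trace : forall e, (exists k, t k = Some e) <-> member G e = true.
Hypothesis g_0 : g 0 = T1 0.
Hypothesis g_S : forall n, g (S n) = next (g n) (t n) (cex n).
Hypothesis cex_Some : forall n m, cex n = Some m ->
  member (g n) (elem_of m) = true /\ member G (elem_of m) = false /\
  exists j e, j < n /\ t j = Some e /\ m < of_elem e.
Hypothesis cex_None : forall n j e e', cex n = None ->
  member (g n) e = true -> member G e = false -> j < n -> t j = Some e' ->
  ~ of_elem e < of_elem e'.

Let datum (n : nat) (e : elem) : t n = Some e -> member G e = true.
Proof. intro h. apply trace. now exists n. Qed.

Definition identified : Prop :=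
  exists N, forall n, N <= n -> forall e, member (g n) e = member G e.

Lemma probe_T1 (i : nat) : G = T1 i -> identified.
Proof.
  intro eG.
  destruct (proj2 (trace (A i 0))) as [k hk]; [rewrite eG; apply Nat.eqb_refl|].
  exists (S k).
  assert (inv : forall n, exists j, g n = T1 j /\ (k < n -> j = i)).
  { induction n as [|n [j [hj ij]]]; [exists 0; split; [exact g_0 | lia]|].
    rewrite g_S, hj. cbn [next]. destruct (t n) as [e|] eqn:et.
    - assert (he := datum n e et). rewrite eG in he.
      destruct e as [j' m|d m|r d s]; cbn in he; try discriminate.
      apply Nat.eqb_eq in he. subst j'. now exists i.
    - exists j. split; [reflexivity|]. intro lt. apply ij.
      destruct (Nat.eq_dec k n) as [->|]; [congruence | lia]. }
  intros n hn e. destruct (inv n) as [j [-> ij]]. rewrite ij by lia. now rewrite eG.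
Qed.

(** All [M r' d s] have the language of the target, so the verifier has no objection, and the trace
    contains no [X] that would make the engine leave. *)
Lemma probe_M (r d s : nat) : G = M r d s -> identified.
Proof.
  intro eG.
  destruct (proj2 (trace (Q 0 d s))) as [k hk].
  { rewrite eG. cbn. now rewrite !Nat.eqb_refl. }
  exists (S k).
  assert (inv : forall n, (exists j, g n = T1 j /\ n <= k) \/ exists r', g n = M r' d s).
  { induction n as [|n IH]; [left; exists 0; split; [exact g_0 | lia]|].
    rewrite g_S. destruct IH as [[j [-> le]]|[r' e]].
    - cbn [next]. destruct (t n) as [e|] eqn:et.
      + assert (he := datum n e et). rewrite eG in he.
        destruct e as [j' m|d' m|r' d' s']; cbn in he; try discriminate; bool_hyps.
        * left. exists (d_i d). split; [reflexivity|].
          destruct (Nat.eq_dec k n) as [->|]; [congruence | lia].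
        * right. now exists 0.
      + left. exists j. split; [reflexivity|].
        destruct (Nat.eq_dec k n) as [->|]; [congruence | lia].
    - right. rewrite e. destruct (cex n) as [m|] eqn:ec.
      + destruct (cex_Some n m ec) as [h1 [h2 _]]. rewrite e in h1. rewrite eG in h2.
        destruct (elem_of m); cbn in h1, h2; congruence.
      + exists r'. cbn [next]. destruct (t n) as [x|] eqn:et; [|reflexivity].
        assert (he := datum n x et). rewrite eG in he. destruct x; cbn in he; [reflexivity | discriminate | reflexivity]. }
  intros n hn e. destruct (inv n) as [[j [_ le]]|[r' ->]]; [lia|].
  rewrite eG. now destruct e.
Qed.

Lemma probe_T2 (d : nat) : G = T2 d -> identified.
Proof.
  intro eG.
  destruct (proj2 (trace (X d 0))) as [k0 hk0]; [rewrite eG; apply Nat.eqb_refl|].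
  destruct (proj2 (trace (X d 1))) as [k1 hk1]; [rewrite eG; apply Nat.eqb_refl|].
  (* In the [M] stage every [X] presented so far is one and the same element, recorded in [s]; any
     further [X] ends that stage. *)
  assert (inv : forall n,
    (exists j, g n = T1 j /\ forall m d' x, m < n -> t m <> Some (X d' x)) \/
    (exists s, g n = M 0 d s /\
       forall m d' x, m < n -> t m = Some (X d' x) -> s = add_to_set 0 x) \/
    g n = T2 d).
  { induction n as [|n IH]; [left; exists 0; split; [exact g_0 | lia]|].
    rewrite g_S. destruct IH as [[j [-> no]]|[[s [e old]]| ->]].
    - cbn [next]. destruct (t n) as [x|] eqn:et.
      + assert (he := datum n x et). rewrite eG in he.
        destruct x as [j' m|d' x|r' d' s']; cbn in he; try discriminate; bool_hyps.
        * left. exists (d_i d). split; [reflexivity|].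
          intros m' d' x lt. destruct (Nat.eq_dec m' n) as [->|]; [congruence | apply no; lia].
        * right. left. exists (add_to_set 0 x). split; [reflexivity|].
          intros m' d' x' lt h. destruct (Nat.eq_dec m' n) as [->|ne]; [congruence|].
          exfalso. apply (no m' d' x'); [lia | exact h].
      + left. exists j. split; [reflexivity|].
        intros m' d' x lt. destruct (Nat.eq_dec m' n) as [->|]; [congruence | apply no; lia].
    (* The target contains [A i c], so a counterexample would be some [Q r' d s] below a datum; but
       each datum is an [A] of [T2 d] or the [X] recorded in [s]. *)
    - assert (ec : cex n = None).
      { destruct (cex n) as [m|] eqn:ec; [exfalso|reflexivity].
        destruct (cex_Some n m ec) as [h1 [h2 [j [y [lt [ej lm]]]]]].
        rewrite e in h1. rewrite eG in h2.
        assert (hy := datum j y ej). rewrite eG in hy.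
        rewrite <- (of_elemK m) in lm.
        destruct (elem_of m) as [i' m'|d' m'|r' d' s']; cbn in h1; try discriminate; bool_hyps.
        - cbn in h2. now rewrite !Nat.eqb_refl, orb_true_r in h2.
        - destruct y as [i' y|d' y|]; cbn in hy; try discriminate; bool_hyps.
          + assert (h := A_le_Q r' d s y).
            rewrite <- Nat.ltb_lt, <- Nat.eqb_eq, <- orb_true_iff in h.
            specialize (h ltac:(assumption)). lia.
          + assert (h := X_le_Q r' d s y). rewrite (old j d y lt ej) in h at 1.
            specialize (h (in_set_le _ _ ltac:(now rewrite in_set_add, Nat.eqb_refl))). lia. }
      rewrite e, ec. cbn [next]. destruct (t n) as [x|] eqn:et.
      + destruct x as [j' m|d' x|r' d' s']; [|now right; right|];
          right; left; exists s; (split; [reflexivity|]);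
          intros m' d'' x lt h; (destruct (Nat.eq_dec m' n) as [->|]; [congruence|]);
          apply (old m' d'' x); (lia || exact h).
      + right. left. exists s. split; [reflexivity|].
        intros m' d' x lt h. destruct (Nat.eq_dec m' n) as [->|]; [congruence|].
        apply (old m' d' x); (lia || exact h).
    - now right; right. }
  exists (S (max k0 k1)). intros n hn e.
  destruct (inv n) as [[j [_ no]]|[[s [_ old]]| ->]].
  - exfalso. apply (no k0 d 0); [lia | exact hk0].
  (* Both [X d 0] and [X d 1] have been presented, and no single record fits the two. *)
  - assert (e0 := old k0 d 0 ltac:(lia) hk0). assert (e1 := old k1 d 1 ltac:(lia) hk1).
    rewrite e0 in e1. discriminate.
  - now rewrite eG.
Qed.

Lemma probe_L (d s : nat) : G = L d s -> identified.
Proof.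
  intro eG.
  assert (eX : forall n, in_set s n = true -> exists k, t k = Some (X d n)).
  { intros n hn. apply trace. rewrite eG. cbn. now rewrite Nat.eqb_refl, hn. }
  assert (eX' : forall k d' n, t k = Some (X d' n) -> d' = d /\ in_set s n = true).
  { intros k d' n h. apply datum in h. rewrite eG in h. cbn in h. bool_hyps. auto. }
  destruct (eX 0 eq_refl) as [k0 hk0].
  (* The set is finite, so a single bound [N] covers the presentation of all its [X d n]. *)
  assert (all : forall b, exists N, forall n, n < b -> in_set s n = true ->
                exists k, k < N /\ t k = Some (X d n)).
  { induction b as [|b [N hN]]; [exists 0; lia|].
    destruct (in_set s b) eqn:eb.
    - destruct (eX b eb) as [k hk]. exists (max N (S k)). intros n lt hn.
      destruct (Nat.eq_dec n b) as [->|]; [exists k; split; [lia | exact hk]|].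
      destruct (hN n) as [k' [lt' hk']]; [lia | exact hn|]. exists k'. split; [lia | exact hk'].
    - exists N. intros n lt hn. apply hN; [|exact hn].
      destruct (Nat.eq_dec n b) as [->|]; [congruence | lia]. }
  destruct (all (S s)) as [N hN].
  set (sees := fun n s' => (forall m, in_set s' m = true -> in_set s m = true) /\
    forall k d' x, k < n -> t k = Some (X d' x) -> in_set s' x = true).
  assert (sees_same : forall n s', sees n s' -> (forall d' x, t n <> Some (X d' x)) -> sees (S n) s').
  { intros n s' [h1 h2] no. split; [exact h1|]. intros k d' x lt hk.
    destruct (Nat.eq_dec k n) as [->|]; [now apply no in hk|]. apply (h2 k d'); [lia | exact hk]. }
  assert (sees_add : forall n s' d' x, sees n s' -> t n = Some (X d' x) -> sees (S n) (add_to_set s' x)).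
  { intros n s' d' x [h1 h2] hx. split.
    - intros m. rewrite in_set_add, orb_true_iff, Nat.eqb_eq.
      intros [->|h]; [exact (proj2 (eX' n d' x hx)) | auto].
    - intros k d'' y lt hk. rewrite in_set_add, orb_true_iff, Nat.eqb_eq.
      destruct (Nat.eq_dec k n) as [->|]; [left; congruence|]. right. apply (h2 k d''); [lia | exact hk]. }
  (* The [M] stage is entered on the first [X], hence at index [S k0] at the latest, and lasts a
     single step. *)
  assert (inv : forall n,
    (exists j, g n = T1 j /\ forall m d' x, m < n -> t m <> Some (X d' x)) \/
    (exists s', g n = M 0 d s' /\ sees n s' /\ n <= S k0 /\ exists k x, k < n /\ t k = Some (X d x)) \/
    (exists s', g n = L d s' /\ sees n s')).
  { induction n as [|n IH]; [left; exists 0; split; [exact g_0 | lia]|].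
    rewrite g_S. destruct IH as [[j [-> no]]|[[s' [e [hs [le [k [x [lt hk]]]]]]]|[s' [-> hs]]]].
    - assert (nk0 : n <= k0) by (destruct (le_lt_dec n k0); [lia | now apply no in hk0]).
      cbn [next]. destruct (t n) as [x|] eqn:et.
      + assert (he := datum n x et). rewrite eG in he.
        destruct x as [j' m|d' x|r' d' s']; cbn in he; try discriminate; bool_hyps.
        * left. exists (d_i d). split; [reflexivity|].
          intros m' d' x lt. destruct (Nat.eq_dec m' n) as [->|]; [congruence | apply no; lia].
        * right. left. exists (add_to_set 0 x). split; [reflexivity|].
          split; [apply (sees_add n 0 d x)|split].
          -- split; [|intros k d' y lt h; now apply no in h].
             intros m hm. rewrite in_set_zero in hm. apply Nat.eqb_eq in hm. now subst m.
          -- exact et.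
          -- lia.
          -- exists n, x. split; [lia | exact et].
      + left. exists j. split; [reflexivity|].
        intros m' d' x lt. destruct (Nat.eq_dec m' n) as [->|]; [congruence | apply no; lia].
    - right. right. destruct (cex n) as [m|] eqn:ec.
      + rewrite e. cbn [next]. destruct (t n) as [y|] eqn:et.
        * destruct y as [j' y|d' y|r' d' s''].
          -- exists s'. split; [reflexivity|]. apply sees_same; [exact hs | congruence].
          -- exists (add_to_set s' y). split; [reflexivity|]. now apply sees_add with d'.
          -- exists s'. split; [reflexivity|]. apply sees_same; [exact hs | congruence].
        * exists s'. split; [reflexivity|]. apply sees_same; [exact hs | congruence].
      (* Silence is impossible: [A i c] is wrong here and lies below the [X d x] already
         presented. *)
      + exfalso. apply (cex_None n k (A (d_i d) (d_c d)) (X d x) ec); auto.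
        * rewrite e. cbn. now rewrite !Nat.eqb_refl.
        * rewrite eG. cbn. now rewrite !Nat.eqb_refl, !andb_false_r.
        * apply A_lt_X.
    - right. right. cbn [next]. destruct (t n) as [y|] eqn:et.
      + destruct y as [j' y|d' y|r' d' s''].
        * exists s'. split; [reflexivity|]. apply sees_same; [exact hs | congruence].
        * exists (add_to_set s' y). split; [reflexivity|]. now apply sees_add with d'.
        * exists s'. split; [reflexivity|]. apply sees_same; [exact hs | congruence].
      + exists s'. split; [reflexivity|]. apply sees_same; [exact hs | congruence]. }
  exists (max N (S (S k0))). intros n hn e.
  destruct (inv n) as [[j [_ no]]|[[s' [_ [_ [le _]]]]|[s' [-> [h1 h2]]]]].
  - exfalso. apply (no k0 d 0); [lia | exact hk0].
  - lia.
  - rewrite eG. f_equal. f_equal. apply in_set_inj. intro m.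
    apply eq_true_iff_eq. split; [apply h1|]. intro hm.
    destruct (hN m) as [k [lt hk]]; [apply in_set_le in hm; lia | exact hm|].
    apply (h2 k d); [lia | exact hk].
Qed.

Lemma probe_identified : identified.
Proof.
  exact (match G as G' return G = G' -> identified with
         | T1 i => probe_T1 i | T2 d => probe_T2 d | L d s => probe_L d s | M r d s => probe_M r d s
         end eq_refl).
Qed.
End probe.

Lemma probe_HCEGIS : HCEGIS probe_family.
Proof.
  exists probe_engine. intros i tau cex tr ok.
  destruct (probe_identified (prog_of i) (fun n => option_map elem_of (tau n)) cex
              (fun n => prog_of (hyp probe_engine tau cex n))) as [N hN].
  - intro e. split.
    + intros [k hk]. destruct (tau k) as [x|] eqn:ek; [|discriminate].
      cbn in hk. injection hk as <-. apply (tr x). now exists k.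
    + intro he. destruct (proj2 (tr (of_elem e))) as [k hk].
      { unfold Lang; cbn [TEMPLATE probe_family]. now rewrite elem_ofK. }
      exists k. rewrite hk. cbn. now rewrite elem_ofK.
  - apply prog_ofK.
  - intro n. apply prog_ofK.
  - intros n m ec. specialize (ok n). rewrite ec in ok.
    destruct ok as [h1 [h2 [j [x [lt [ej lm]]]]]]. split; [exact h1|]. split.
    + apply not_true_is_false. exact h2.
    + exists j, (elem_of x). rewrite ej, of_elemK. auto.
  - intros n j e e' ec h1 h2 lt ej lm. specialize (ok n). rewrite ec in ok. apply ok.
    exists (of_elem e). unfold hcex_candidate, Lang. cbn [TEMPLATE probe_family].
    rewrite elem_ofK, h2. split; [exact h1|]. split; [discriminate|].
    destruct (tau j) as [x|] eqn:ex; [|discriminate]. cbn in ej. injection ej as <-.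
    exists j, x. now rewrite of_elemK in lm.
  - exists N. intros n hn x. apply hN, hn.
Qed.

(** * No CEGIS engine for the probe family *)

Lemma least_witness (P : nat -> Prop) :
  (exists n, P n) -> exists n, P n /\ forall m, m < n -> ~ P m.
Proof.
  intros [n hn]. induction n as [n IH] using lt_wf_ind.
  destruct (classic (exists m, m < n /\ P m)) as [[m [lt hm]]|no].
  - exact (IH m lt hm).
  - exists n. split; [exact hn|]. intros m lt hm. apply no. now exists m.
Qed.

Definition splice {T : Type} (n : nat) (t u : nat -> T) (k : nat) : T :=
  if k <? n then t k else u (k - n).

Lemma splice_l {T : Type} (n : nat) (t u : nat -> T) (k : nat) : k < n -> splice n t u k = t k.
Proof. intro lt. unfold splice. now rewrite (proj2 (Nat.ltb_lt k n) lt). Qed.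

Lemma splice_r {T : Type} (n : nat) (t u : nat -> T) (k : nat) : splice n t u (n + k) = u k.
Proof.
  unfold splice. destruct (Nat.ltb_spec (n + k) n); [lia|]. f_equal. lia.
Qed.

Lemma splice_exists {T : Type} (n : nat) (t u : nat -> T) (x : T) :
  (exists k, splice n t u k = x) <-> (exists k, k < n /\ t k = x) \/ exists k, u k = x.
Proof.
  split.
  - intros [k hk]. destruct (le_lt_dec n k) as [l|l].
    + right. exists (k - n). rewrite <- hk, <- (splice_r n t u). f_equal. lia.
    + left. exists k. split; [exact l|]. now rewrite <- hk, splice_l.
  - intros [[k [lt hk]]|[k hk]].
    + exists k. now rewrite splice_l.
    + exists (n + k). now rewrite splice_r.
Qed.

Definition same_language (g g' : prog) : Prop := forall e, member g e = member g' e.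

Lemma in_set_succ_self (s : nat) : in_set s (S s) = false.
Proof.
  apply not_true_is_false. intro h. apply in_set_le in h. lia.
Qed.

(** [X d 0] reveals [d], [X d (S s)] tells [T2 d] from [L d s], and the remaining [X d n] spell out
    [s]. [M] is excluded because its language does not show [r]. *)
Lemma same_language_rigid (g g' : prog) :
  match g' with M _ _ _ => False | _ => True end -> same_language g g' -> g = g'.
Proof.
  intros hg' h. destruct g' as [i|d|d s|]; [| | |contradiction]; clear hg'.
  - assert (h0 := h (A i 0)). destruct g as [j|d|d s|r d s].
    + cbn in h0. rewrite Nat.eqb_refl in h0. apply Nat.eqb_eq in h0. now subst.
    + specialize (h (X d 0)). cbn in h. now rewrite Nat.eqb_refl in h.
    + specialize (h (X d 0)). cbn in h. now rewrite Nat.eqb_refl in h.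
    + specialize (h (Q 0 d s)). cbn in h. now rewrite !Nat.eqb_refl in h.
  - assert (h0 := h (X d 0)). cbn in h0. rewrite Nat.eqb_refl in h0.
    destruct g as [j|d'|d' s|r d' s]; cbn in h0; try discriminate; bool_hyps; [reflexivity|].
    specialize (h (X d' (S s))). cbn [member] in h.
    now rewrite Nat.eqb_refl, in_set_succ_self in h.
  - assert (h0 := h (X d 0)). cbn in h0. rewrite Nat.eqb_refl in h0.
    destruct g as [j|d'|d' s'|r d' s']; cbn in h0; try discriminate; bool_hyps.
    + specialize (h (X d' (S s))). cbn [member] in h.
      now rewrite Nat.eqb_refl, in_set_succ_self in h.
    + f_equal. apply in_set_inj. intro n. specialize (h (X d' n)). cbn [member] in h.
      now rewrite Nat.eqb_refl in h.
Qed.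

Definition valid (G g : prog) (c : option elem) : Prop :=
  match c with
  | None => forall e, member g e = true -> member G e = true
  | Some e => member g e = true /\ member G e = false
  end.

Lemma valid_answers_exist (G : prog) : exists ans, forall g, valid G g (ans g).
Proof.
  assert (H : forall g, exists c, valid G g c).
  { intro g. destruct (classic (exists e, member g e = true /\ member G e = false)) as [[e he]|no].
    - now exists (Some e).
    - exists None. intros e he. apply not_false_is_true. intro hG. apply no. now exists e. }
  exists (fun g => proj1_sig (constructive_indefinite_description _ (H g))).
  intro g. apply proj2_sig.
Qed.

Definition is_text (G : prog) (t : nat -> option elem) : Prop :=
  forall e, (exists k, t k = Some e) <-> member G e = true.

(* Answers of the verifier at [T1 i] (for the target [T1 i]) and after it (for targets [T2 d], [L d s]);
   every other program is refuted by an element that carries no information on the target. *)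
Definition ans1 (i : nat) (g : prog) : option elem :=
  match g with
  | T1 j => if j =? i then None else Some (A j 0)
  | T2 d => Some (X d 0)
  | L d _ => Some (X d 0)
  | M _ d s => Some (Q 0 d s)
  end.

Definition ans2 (d : nat) (b : option elem) (g : prog) : option elem :=
  match g with
  | T1 j => Some (A j (if j =? d_i d then d_v d else 0))
  | T2 d' => if d' =? d then b else Some (X d' 0)
  | L d' _ => if d' =? d then None else Some (X d' 0)
  | M _ d' s => Some (Q 0 d' s)
  end.

Lemma ans1_valid (i : nat) (g : prog) : valid (T1 i) g (ans1 i g).
Proof.
  destruct g as [j|d|d s|r d s]; cbn.
  - destruct (Nat.eqb_spec j i) as [->|ne]; [now intros|].
    cbn. rewrite Nat.eqb_refl. now apply Nat.eqb_neq in ne.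
  - now rewrite Nat.eqb_refl.
  - now rewrite Nat.eqb_refl.
  - now rewrite !Nat.eqb_refl.
Qed.

(** [A i v] is outside [T2 d] as [v] differs from [c]; silence at [L d s] is right since that
    language is contained in [T2 d]. *)
Lemma ans2_valid_T2 (d : nat) (g : prog) : d_c d < d_v d -> valid (T2 d) g (ans2 d None g).
Proof.
  intro cv. destruct g as [j|d'|d' s|r d' s]; cbn [ans2].
  - cbn [valid member]. rewrite Nat.eqb_refl. split; [reflexivity|].
    destruct (Nat.eqb_spec j (d_i d)) as [->|]; [|reflexivity].
    rewrite Nat.ltb_irrefl. cbn [andb orb]. apply Nat.eqb_neq. lia.
  - destruct (Nat.eqb_spec d' d) as [->|ne]; [now intros|].
    cbn [valid member]. rewrite Nat.eqb_refl. now apply Nat.eqb_neq in ne.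
  - destruct (Nat.eqb_spec d' d) as [->|ne].
    + intros [j n|d' n|r d' s'] he; cbn [member] in he |- *; try discriminate; bool_hyps.
      * rewrite Nat.eqb_refl. now apply Nat.ltb_lt in H0 as ->.
      * apply Nat.eqb_refl.
    + cbn [valid member]. rewrite Nat.eqb_refl. now apply Nat.eqb_neq in ne.
  - cbn [valid member]. now rewrite !Nat.eqb_refl.
Qed.

(** The answer [A i c] at [T2 d] is right for every [s] and so says nothing about [s]. Silence at
    [L d s'] is right only for [s'] inside [s], hence the second hypothesis. *)
Lemma ans2_valid_L (d s : nat) (g : prog) : d_c d < d_v d ->
  (forall s', g = L d s' -> forall n, in_set s' n = true -> in_set s n = true) ->
  valid (L d s) g (ans2 d (Some (A (d_i d) (d_c d))) g).
Proof.
  intros cv hs. destruct g as [j|d'|d' s'|r d' s']; cbn [ans2].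
  - cbn [valid member]. rewrite Nat.eqb_refl. split; [reflexivity|].
    destruct (Nat.eqb_spec j (d_i d)) as [->|]; [|reflexivity].
    now rewrite Nat.ltb_irrefl, andb_false_r.
  - destruct (Nat.eqb_spec d' d) as [->|ne]; cbn [valid member].
    + now rewrite !Nat.eqb_refl, orb_true_r, !andb_false_r.
    + rewrite Nat.eqb_refl. now apply Nat.eqb_neq in ne as ->.
  - destruct (Nat.eqb_spec d' d) as [->|ne].
    + intros [j n|d' n|r d' s''] he; cbn [member] in he |- *; try discriminate.
      * exact he.
      * bool_hyps. rewrite Nat.eqb_refl. now apply (hs s').
    + cbn [valid member]. rewrite Nat.eqb_refl. now apply Nat.eqb_neq in ne as ->.
  - cbn [valid member]. now rewrite !Nat.eqb_refl.
Qed.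

Lemma ans2_eq_ans1 (d : nat) (b : option elem) (g : prog) :
  g <> T1 (d_i d) -> g <> T2 d -> (forall s, g <> L d s) -> ans2 d b g = ans1 (d_i d) g.
Proof.
  intros h1 h2 h3. destruct g as [j|d'|d' s|r d' s]; cbn.
  - destruct (Nat.eqb_spec j (d_i d)) as [->|]; [now contradict h1 | reflexivity].
  - destruct (Nat.eqb_spec d' d) as [->|]; [now contradict h2 | reflexivity].
  - destruct (Nat.eqb_spec d' d) as [->|]; [now contradiction (h3 s) | reflexivity].
  - reflexivity.
Qed.

(** Supplies the finite set of a target [L d s] that contains all [X d y] presented in a prefix. *)
Lemma fed_set (d : nat) (t : nat -> option elem) (n s0 : nat) :
  exists s, forall y, in_set s y = true <->
    in_set s0 y = true \/ exists m, m < n /\ t m = Some (X d y).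
Proof.
  induction n as [|n [s hs]].
  - exists s0. intro y. split; [now left|]. intros [h|[m [lt _]]]; [exact h | lia].
  - assert (H : (exists x, t n = Some (X d x)) \/ forall x, t n <> Some (X d x)).
    { destruct (classic (exists x, t n = Some (X d x))) as [h|no]; [now left|].
      right. intros x hx. apply no. now exists x. }
    destruct H as [[x hx]|no].
    + exists (add_to_set s x). intro y. rewrite in_set_add, orb_true_iff, Nat.eqb_eq, hs. split.
      * intros [->|[h|[m [lt h]]]]; [right; exists n; auto | now left | right; exists m; auto].
      * intros [h|[m [lt h]]]; [auto|].
        destruct (Nat.eq_dec m n) as [->|]; [left; congruence|].
        right. right. exists m. split; [lia | exact h].
    + exists s. intro y. rewrite hs. split.
      * intros [h|[m [lt h]]]; [now left | right; exists m; auto].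
      * intros [h|[m [lt h]]]; [now left|]. right. exists m. split; [|exact h].
        destruct (Nat.eq_dec m n) as [->|]; [now apply no in h | lia].
Qed.

Lemma bounded_prefix (f : nat -> nat) (n : nat) : exists b, forall k, k < n -> f k < b.
Proof.
  induction n as [|n [b hb]]; [exists 0; lia|].
  exists (max b (S (f n))). intros k lt.
  destruct (Nat.eq_dec k n) as [->|]; [lia|]. specialize (hb k). lia.
Qed.

(** * Runs of an engine against a verifier without memory *)

Section run.
Variable E : engine.

Definition advance (g : prog) (t c : option elem) : prog :=
  prog_of (F E (of_prog g) (option_map of_elem t) (option_map of_elem c)).

(** The answer is a function of the current program alone. The rest of a run then depends only on
    that program and on the remaining text, so that different histories leading to it can be
    exchanged. *)
Fixpoint run (ans : prog -> option elem) (g : prog) (t : nat -> option elem) (n : nat) : prog :=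
  match n with
  | 0 => g
  | S n => advance (run ans g t n) (t n) (ans (run ans g t n))
  end.

Lemma run_splice_l (ans : prog -> option elem) (g : prog) (n : nat) (t u : nat -> option elem) (k : nat) :
  k <= n -> run ans g (splice n t u) k = run ans g t k.
Proof.
  induction k as [|k IH]; intro le; [reflexivity|].
  cbn [run]. now rewrite IH, splice_l by lia.
Qed.

Lemma run_splice_r (ans : prog -> option elem) (g : prog) (n : nat) (t u : nat -> option elem) (k : nat) :
  run ans g (splice n t u) (n + k) = run ans (run ans g t n) u k.
Proof.
  induction k as [|k IH]; [rewrite Nat.add_0_r; now rewrite run_splice_l by lia|].
  rewrite Nat.add_succ_r. cbn [run]. now rewrite IH, splice_r.
Qed.

Lemma run_ext (ans ans' : prog -> option elem) (g : prog) (t : nat -> option elem) (n : nat) :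
  (forall k, k < n -> ans (run ans g t k) = ans' (run ans g t k)) ->
  forall k, k <= n -> run ans' g t k = run ans g t k.
Proof.
  intros h k. induction k as [|k IH]; intro le; [reflexivity|].
  cbn [run]. now rewrite IH, h by lia.
Qed.

Hypothesis identifies : forall i, CEGIS_identifies probe_family E i.

Let start : prog := prog_of (P_init E).

(** Identification gives convergence of the language; rigidity of [G] turns it into convergence of
    the program. *)
Lemma run_converges (G : prog) (ans : prog -> option elem) (t : nat -> option elem) :
  match G with M _ _ _ => False | _ => True end ->
  is_text G t ->
  (forall n, valid G (run ans start t n) (ans (run ans start t n))) ->
  exists N, forall n, N <= n -> run ans start t n = G.
Proof.
  intros rigid text ok.
  set (tau := fun n => option_map of_elem (t n)).
  set (cex := fun n => option_map of_elem (ans (run ans start t n))).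
  assert (eh : forall n, hyp E tau cex n = of_prog (run ans start t n)).
  { induction n as [|n IH]; cbn [hyp run].
    - unfold start. now rewrite of_progK.
    - unfold advance. rewrite of_progK, IH. reflexivity. }
  assert (el : forall h e, Lang probe_family (of_prog h) (of_elem e) <-> member h e = true).
  { intros h e. unfold Lang. cbn [TEMPLATE probe_family]. now rewrite prog_ofK, elem_ofK. }
  destruct (identifies (of_prog G) tau cex) as [N hN].
  - intro x. rewrite <- (of_elemK x), el, <- (text (elem_of x)). unfold SMPL, tau. split; intros [k hk]; exists k.
    + destruct (t k) as [e|]; [|discriminate]. cbn in hk. injection hk as hk.
      rewrite <- (elem_ofK e). now rewrite hk, elem_ofK.
    + now rewrite hk.
  - intro n. rewrite eh. unfold cex. specialize (ok n).
    destruct (ans (run ans start t n)) as [e|]; cbn in ok |- *.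
    + rewrite !el. destruct ok as [h1 h2]. split; [exact h1 | congruence].
    + intro m. rewrite <- (of_elemK m), !el. apply ok.
  - exists N. intros n hn. apply same_language_rigid; [exact rigid|].
    intro e. specialize (hN n hn (of_elem e)). cbn [TEMPLATE probe_family] in hN.
    now rewrite eh, !prog_ofK, elem_ofK in hN.
Qed.

(* A program with a unique index is a fixed point of the engine as long as nothing contradicts it:
   the datum may come up again and again after convergence. *)
Lemma advance_locked (G : prog) (e : elem) :
  match G with M _ _ _ => False | _ => True end ->
  member G e = true -> advance G (Some e) None = G.
Proof.
  intros rigid he. destruct (valid_answers_exist G) as [ans ok].
  set (t := fun n => if Nat.even n then
                       (if member G (elem_of (Nat.div2 n)) then Some (elem_of (Nat.div2 n)) else Some e)
                     else Some e).
  destruct (run_converges G ans t rigid) as [N hN]; [|intro; apply ok|].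
  - intro e'. split.
    + intros [k hk]. unfold t in hk. destruct (Nat.even k); [|now injection hk as <-].
      destruct (member G (elem_of (Nat.div2 k))) eqn:em; injection hk as <-; assumption.
    + intro he'. exists (2 * of_elem e'). unfold t.
      rewrite Nat.even_mul, Nat.div2_double, elem_ofK, he'. reflexivity.
  - assert (ea : ans G = None).
    { specialize (ok G). destruct (ans G); [|reflexivity]. cbn in ok. destruct ok. congruence. }
    (* The position [S (2 * N)] is odd and beyond [N]: there the engine is at [G], reads [e] and has
       to remain at [G]. *)
    assert (h := hN (S (S (2 * N))) ltac:(lia)). cbn [run] in h.
    change (advance (run ans start t (S (2 * N))) (t (S (2 * N))) (ans (run ans start t (S (2 * N)))) = G) in h.
    rewrite hN, ea in h by lia. unfold t in h.
    rewrite Nat.even_succ, <- Nat.negb_even, Nat.even_mul in h. exact h.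
Qed.

Lemma first_visit (i : nat) (t : nat -> option elem) : is_text (T1 i) t ->
  exists n, run (ans1 i) start t n = T1 i /\ forall m, m < n -> run (ans1 i) start t m <> T1 i.
Proof.
  intro text. apply least_witness.
  destruct (run_converges (T1 i) (ans1 i) t I text) as [N hN].
  - intro n. apply ans1_valid.
  - exists N. apply hN. lia.
Qed.

(** * From [T1 i] to [T2 d] *)

Section second_phase.
Variables (d x : nat).
Hypothesis cv : d_c d < d_v d.
Let ans := ans2 d None.

(** [X d x] comes first, so that it is presented before any visit to [T2 d]. The element [A i c] is
    left out: it is supplied by the earlier history for the target [T2 d], and must be absent for
    the targets [L d s]. *)
Definition enum (k : nat) : option elem :=
  match k with
  | 0 => Some (X d x)
  | S k => match elem_of k with
           | A j n => if member (T2 d) (A j n) && negb (n =? d_c d) then Some (A j n) else None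
           | e => if member (T2 d) e then Some e else None
           end
  end.

Definition block (g : prog) : list elem :=
  match g with
  | L d' s => if d' =? d then map (X d) (filter (in_set s) (seq 0 (S s))) else []
  | _ => []
  end.

(* Whenever the engine conjectures some [L d s], the whole of [L d s] is presented to it before
   it can leave that conjecture. *)
Fixpoint conf (n : nat) : prog * nat * list elem :=
  match n with
  | 0 => (T1 (d_i d), 0, [])
  | S n => match conf n with
           | (g, k, e :: r) => (advance g (Some e) (ans g), k, r)
           | (g, k, []) => let g' := advance g (enum k) (ans g) in (g', S k, block g')
           end
  end.

Definition feed (n : nat) : option elem :=
  match conf n with (_, _, e :: _) => Some e | (_, k, []) => enum k end.

Let state (n : nat) : prog := fst (fst (conf n)).

Lemma run_feed (n : nat) : run ans (T1 (d_i d)) feed n = state n.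
Proof.
  induction n as [|n IH]; [reflexivity|]. cbn [run]. rewrite IH. unfold feed, state. cbn [conf].
  now destruct (conf n) as [[g k] [|e r]].
Qed.

Lemma in_block (g : prog) (e : elem) : In e (block g) -> exists s, g = L d s /\ member g e = true.
Proof.
  destruct g as [|?|d' s|]; cbn [block In]; try contradiction.
  destruct (Nat.eqb_spec d' d) as [->|]; [|contradiction].
  rewrite in_map_iff. intros [y [<- hy]]. apply filter_In in hy. exists s. split; [reflexivity|].
  cbn. now rewrite Nat.eqb_refl.
Qed.

Lemma block_full (s y : nat) : in_set s y = true -> In (X d y) (block (L d s)).
Proof.
  intro hy. cbn [block]. rewrite Nat.eqb_refl. apply in_map, filter_In. split; [|exact hy].
  apply in_set_le in hy. apply in_seq. lia.
Qed.

Lemma enum_T2 (k : nat) (e : elem) : enum k = Some e ->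
  member (T2 d) e = true /\ e <> A (d_i d) (d_c d).
Proof.
  destruct k as [|k]; cbn [enum].
  - intros [= <-]. split; [apply Nat.eqb_refl | discriminate].
  - destruct (elem_of k) as [j n|d' n|r d' s].
    + destruct (member (T2 d) (A j n)) eqn:em; [|discriminate].
      destruct (Nat.eqb_spec n (d_c d)); [discriminate|]. intros [= <-]. split; [exact em | congruence].
    + destruct (member (T2 d) (X d' n)) eqn:em; [|discriminate]. intros [= <-]. split; [exact em | discriminate].
    + discriminate.
Qed.

Lemma enum_onto (e : elem) : member (T2 d) e = true -> e <> A (d_i d) (d_c d) -> exists k, enum k = Some e.
Proof.
  intros he ne. exists (S (of_elem e)). unfold enum. rewrite elem_ofK.
  destruct e as [j n|d' n|r d' s]; rewrite he; [|reflexivity..].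
  cbn [member] in he. bool_hyps. destruct (Nat.eqb_spec n (d_c d)) as [e|]; [congruence | reflexivity].
Qed.

(** The pending elements belong to the current [L d s] and the verifier is silent there, so
    [advance_locked] holds the engine until the queue is empty. *)
Lemma conf_todo (n : nat) (e : elem) : In e (snd (conf n)) ->
  exists s, state n = L d s /\ member (state n) e = true.
Proof.
  unfold state. revert e. induction n as [|n IH]; intros e; [contradiction|].
  cbn [conf]. destruct (conf n) as [[g k] [|e' r]]; cbn [fst snd] in *.
  - apply in_block.
  - intro hr. destruct (IH e' (or_introl eq_refl)) as [s [-> he']].
    assert (ea : ans (L d s) = None) by (cbn; now rewrite Nat.eqb_refl).
    rewrite ea, advance_locked by (exact I || assumption).
    exact (IH e (or_intror hr)).
Qed.

Definition fed (n y : nat) : Prop := exists m, m < n /\ feed m = Some (X d y).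

Lemma fed_S (n y : nat) : fed n y -> fed (S n) y.
Proof. intros [m [lt h]]. exists m. split; [lia | exact h]. Qed.

(** The program can change only when the queue is empty; by then the whole block of the conjecture
    being left has been presented. *)
Lemma conf_invariant (n : nat) :
  (forall s y, state n = L d s -> in_set s y = true -> In (X d y) (snd (conf n)) \/ fed n y) /\
  (forall m s y, m < n -> state m = L d s -> state m <> state n -> in_set s y = true -> fed n y).
Proof.
  induction n as [|n [IHb IHc]].
  - split; [intros s y h; discriminate h | lia].
  - assert (ht := conf_todo n).
    assert (hS : (exists e r, snd (conf n) = e :: r /\ feed n = Some e /\
                    state (S n) = state n /\ snd (conf (S n)) = r) \/
                 (snd (conf n) = [] /\ snd (conf (S n)) = block (state (S n)))).
    { unfold state, feed in *. cbn [conf].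
      destruct (conf n) as [[g k] [|e r]]; cbn [fst snd] in *; [now right|]. left.
      exists e, r. repeat split. destruct (ht e (or_introl eq_refl)) as [s [-> he]].
      assert (ea : ans (L d s) = None) by (cbn; now rewrite Nat.eqb_refl).
      rewrite ea. now apply advance_locked. }
    destruct hS as [[e [r [e1 [e2 [e3 e4]]]]]|[e1 e2]].
    + rewrite e3, e4. rewrite e1 in IHb. split.
      * intros s y hs hy. destruct (IHb s y hs hy) as [[->|h]|h].
        -- right. exists n. split; [lia | exact e2].
        -- now left.
        -- right. now apply fed_S.
      * intros m s y lt hs ne hy. apply fed_S.
        destruct (Nat.eq_dec m n) as [->|]; [contradiction|]. apply (IHc m s); auto. lia.
    + rewrite e2. rewrite e1 in IHb. split.
      * intros s y hs hy. left. rewrite hs. now apply block_full.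
      * intros m s y lt hs _ hy. apply fed_S.
        destruct (classic (state m = state n)) as [e|ne].
        -- rewrite e in hs. now destruct (IHb s y hs hy).
        -- apply (IHc m s); auto. destruct (Nat.eq_dec m n) as [->|]; [contradiction | lia].
Qed.

(** Every block is finite, so the interruptions never stall the enumeration. *)
Lemma conf_reaches (k : nat) : exists n g, conf n = (g, k, []).
Proof.
  assert (drain : forall r n g k, conf n = (g, k, r) -> exists n g, conf n = (g, k, [])).
  { induction r as [|e r IH]; intros n g k' h; [now exists n, g|].
    apply (IH (S n) (advance g (Some e) (ans g))). cbn [conf]. now rewrite h. }
  induction k as [|k [n [g h]]]; [now exists 0, (T1 (d_i d))|].
  eapply (drain _ (S n)). cbn [conf]. now rewrite h.
Qed.

Lemma feed_T2 (n : nat) (e : elem) : feed n = Some e ->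
  member (T2 d) e = true /\ e <> A (d_i d) (d_c d).
Proof.
  assert (ht := conf_todo n). unfold feed, state in *.
  destruct (conf n) as [[g k] [|e' r]]; [apply enum_T2|].
  intros [= <-]. destruct (ht e' (or_introl eq_refl)) as [s [es hs]]. cbn [fst] in es, hs. subst g.
  destruct e' as [j m|d' m|]; cbn [member] in hs |- *; try discriminate; bool_hyps.
  - rewrite Nat.eqb_refl. apply Nat.ltb_lt in H0 as ->. split; [reflexivity|].
    intros [= ->]. now rewrite Nat.eqb_refl in H1.
  - split; [apply Nat.eqb_refl | discriminate].
Qed.

Lemma feed_onto (e : elem) : member (T2 d) e = true -> e <> A (d_i d) (d_c d) -> exists n, feed n = Some e.
Proof.
  intros he ne. destruct (enum_onto e he ne) as [k hk]. destruct (conf_reaches k) as [n [g h]].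
  exists n. unfold feed. now rewrite h.
Qed.

(** A history containing [A i c], followed by the feed, is a text for [T2 d], so the engine must
    arrive there; at the first arrival [x] and all sets conjectured on the way have been
    presented. *)
Lemma second_visit (n0 : nat) (t0 : nat -> option elem) :
  run ans start t0 n0 = T1 (d_i d) ->
  (forall k e, k < n0 -> t0 k = Some e -> member (T2 d) e = true) ->
  (exists k, k < n0 /\ t0 k = Some (A (d_i d) (d_c d))) ->
  exists n, run ans (T1 (d_i d)) feed n = T2 d /\
    (forall m, m < n -> run ans (T1 (d_i d)) feed m <> T2 d) /\ fed n x /\
    forall m s y, m < n -> run ans (T1 (d_i d)) feed m = L d s -> in_set s y = true -> fed n y.
Proof.
  intros h0 mem0 hidden.
  destruct (least_witness (fun n => run ans (T1 (d_i d)) feed n = T2 d)) as [n [hn least]].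
  - destruct (run_converges (T2 d) ans (splice n0 t0 feed) I) as [N hN].
    + intro e. rewrite splice_exists. split.
      * intros [[k [lt hk]]|[k hk]]; [exact (mem0 k e lt hk) | exact (proj1 (feed_T2 k e hk))].
      * intro he. destruct (classic (e = A (d_i d) (d_c d))) as [->|ne]; [now left|].
        right. now apply feed_onto.
    + intro n. now apply ans2_valid_T2.
    + exists N. rewrite <- h0, <- run_splice_r. apply hN. lia.
  - exists n. split; [exact hn|]. split; [exact least|]. split.
    + exists 0. split; [|reflexivity]. destruct n; [discriminate hn | lia].
    + intros m s y lt hm hy. rewrite run_feed in hn, hm.
      apply (proj2 (conf_invariant n) m s y lt hm); [congruence | exact hy].
Qed.
End second_phase.
End run.

(** * The two histories and the final contradiction *)

Section refutation.
Variable E : engine.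
Hypothesis identifies : forall i, CEGIS_identifies probe_family E i.
Variables (i : nat).
Let start : prog := prog_of (P_init E).
Hypothesis fresh_i : start <> T1 i.

Definition ascending (n : nat) : option elem := Some (A i n).

Definition ascending_after (c n : nat) : option elem :=
  match n with 0 => Some (A i c) | S n => Some (A i n) end.

(* [c] is hidden: the engine may arrive at [T1 i] both with and without having seen [A i c], and then
   be told that [A i v] is missing, for a [v] larger than everything that occurred so far. *)
Lemma hidden_element : exists d nA nB,
  d_i d = i /\ d_c d = nA /\ nA < d_v d /\ 0 < nB /\ nB <= d_v d /\
  (forall b, run E (ans2 d b) start ascending nA = T1 i /\
     forall k, k < nA -> run E (ans2 d b) start ascending k <> T2 d /\
       forall s, run E (ans2 d b) start ascending k <> L d s) /\
  forall b, run E (ans2 d b) start (ascending_after nA) nB = T1 i.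
Proof.
  destruct (first_visit E identifies i ascending) as [nA [hA lA]].
  { intros [j n|d n|r d s]; cbn; split; try (intros [k h]; discriminate h); try discriminate.
    - intros [k [= <- <-]]. apply Nat.eqb_refl.
    - intro e. apply Nat.eqb_eq in e as ->. now exists n. }
  destruct (first_visit E identifies i (ascending_after nA)) as [nB [hB lB]].
  { intros e. split.
    - intros [[|k] [= <-]]; apply Nat.eqb_refl.
    - destruct e as [j n|d n|r d s]; cbn; try discriminate.
      intro e. apply Nat.eqb_eq in e as ->. now exists (S n). }
  fold start in hA, lA, hB, lB.
  destruct (bounded_prefix (fun k => of_prog (run E (ans1 i) start ascending k)) nA) as [bA boundA].
  destruct (bounded_prefix (fun k => of_prog (run E (ans1 i) start (ascending_after nA) k)) nB) as [bB boundB].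
  (* The first [nA] data are [A i 0] to [A i (nA - 1)], so [c = nA] has not been presented. The size
     of [v] puts the codes of [T2 d] and all [L d s] above every program met in the two runs. *)
  set (v := S nA + nB + bA + bB). set (d := mk_d i nA v).
  destruct (mk_d_proj i nA v) as [ei [ec ev]]. fold d in ei, ec, ev.
  assert (vd : v <= d).
  { unfold d, mk_d. assert (h := to_nat_non_decreasing i (to_nat (nA, v))).
    assert (h' := to_nat_non_decreasing nA v). lia. }
  assert (large : forall s, v <= of_prog (T2 d) /\ v <= of_prog (L d s)).
  { intro s. cbn [of_prog]. assert (h := to_nat_non_decreasing 1 d).
    assert (h1 := to_nat_non_decreasing 2 (to_nat (d, s))). assert (h2 := to_nat_non_decreasing d s). lia. }
  (* Before the first visit to [T1 i] the runs avoid all programs on which [ans1 i] and [ans2 d b]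
     differ, so they may be replayed with the latter. *)
  assert (avoid : forall t n b0, (forall k, k < n -> of_prog (run E (ans1 i) start t k) < b0) ->
    b0 <= v -> (forall k, k < n -> run E (ans1 i) start t k <> T1 i) ->
    forall b, run E (ans2 d b) start t n = run E (ans1 i) start t n /\
      forall k, k < n -> run E (ans2 d b) start t k <> T2 d /\
        forall s, run E (ans2 d b) start t k <> L d s).
  { intros t n b0 bound le first b.
    assert (no : forall k, k < n -> run E (ans1 i) start t k <> T2 d /\
                   forall s, run E (ans1 i) start t k <> L d s).
    { intros k lt. specialize (bound k lt). split; [intro e | intros s e]; rewrite e in bound.
      - destruct (large 0). lia.
      - destruct (large s). lia. }
    assert (ext : forall k, k <= n -> run E (ans2 d b) start t k = run E (ans1 i) start t k).
    { apply run_ext. intros k lt. symmetry.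
      assert (h := ans2_eq_ans1 d b (run E (ans1 i) start t k)). rewrite ei in h.
      apply h; [now apply first | apply (no k lt)..]. }
    split; [now apply ext|]. intros k lt. rewrite ext by lia. now apply no. }
  exists d, nA, nB. rewrite ei, ec, ev.
  repeat split.
  - unfold v. lia.
  (* The engine does not start at [T1 i]; thus its second arrival there comes after it has read
     [A i c]. *)
  - destruct nB; [now contradiction fresh_i | lia].
  - unfold v. lia.
  - rewrite <- hA. apply (avoid ascending nA bA); auto. unfold v. lia.
  - apply (avoid ascending nA bA); auto. unfold v. lia.
  - apply (avoid ascending nA bA); auto. unfold v. lia.
  - intro b. rewrite <- hB. apply (avoid (ascending_after nA) nB bB); auto. unfold v. lia.
Qed.

Lemma no_identification : False.
Proof.
  destruct hidden_element as [d [c [nB [ei [ec [cv [posB [Bv [hA hB]]]]]]]]].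
  set (v := d_v d) in *.
  assert (cv' : d_c d < d_v d) by (rewrite ec; exact cv).
  set (ans := ans2 d (Some (A i c))).
  destruct (hA (Some (A i c))) as [hA1 hA2]. fold ans in hA1, hA2.
  (* Whatever is presented after the visit to [T2 d], the engine must end up at a program that contains
     the [X d x] presented before, although it has forgotten [x]. *)
  assert (final : forall x u s0,
    (forall k e, u k = Some e -> member (L d s0) e = true) ->
    (forall e, member (L d s0) e = true -> exists k, u k = Some e) ->
    (forall k s, run E ans (T2 d) u k = L d s -> forall y, in_set s y = true -> in_set s0 y = true) ->
    exists s N, in_set s x = true /\ forall k, N <= k -> run E ans (T2 d) u k = L d s).
  { intros x u s0 u_in u_onto u_L.
    (* The history with [A i c] guarantees the arrival at [T2 d]; the text built below has the other
       history, which reaches the same [T1 i]. *)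
    destruct (second_visit E identifies d x cv' nB (ascending_after c)) as [n [hn [first [fx fL]]]].
    { rewrite ei. apply hB. }
    { intros [|k] e lt [= <-]; cbn [member]; rewrite ei, Nat.eqb_refl, ec.
      - now rewrite Nat.eqb_refl, orb_true_r.
      - cbn [andb]. apply orb_true_iff. left. apply Nat.ltb_lt. lia. }
    { exists 0. split; [exact posB|]. now rewrite ei, ec. }
    rewrite ei in hn, first, fL.
    set (t := feed E d x) in *.
    destruct (fed_set d t n s0) as [s hs].
    (* The two verifiers differ at [T2 d] only, which is not visited before [n]. *)
    assert (same : forall k, k <= n -> run E ans (T1 i) t k = run E (ans2 d None) (T1 i) t k).
    { apply run_ext. intros k lt. specialize (first k lt).
      destruct (run E (ans2 d None) (T1 i) t k) as [j|d'|d' s'|r d' s']; try reflexivity.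
      cbn. destruct (Nat.eqb_spec d' d) as [->|]; [now contradict first | reflexivity]. }
    set (T := splice c ascending (splice n t u)).
    assert (tail : forall k, run E ans start T (c + (n + k)) = run E ans (T2 d) u k).
    { intro k. unfold T. rewrite !run_splice_r. rewrite hA1, same, hn by lia. reflexivity. }
    destruct (run_converges E identifies (L d s) ans T I) as [N hN].
    - intro e. unfold T. rewrite !splice_exists. split.
      + intros [[k [lt [= <-]]]|[[k [lt hk]]|[k hk]]].
        * cbn [member]. rewrite ei, ec, Nat.eqb_refl. fold v. cbn [andb].
          rewrite (proj2 (Nat.ltb_lt k v)) by lia. cbn [andb].
          apply negb_true_iff, Nat.eqb_neq. lia.
        * destruct (feed_T2 E identifies d x k e hk) as [h1 h2].
          destruct e as [j m|d' m|]; cbn [member] in h1 |- *; [| |discriminate].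
          -- apply andb_true_iff in h1. destruct h1 as [h1 h3]. rewrite h1. cbn [andb].
             apply Nat.eqb_eq in h1. subst j.
             destruct (Nat.eqb_spec m (d_c d)) as [->|]; [now contradict h2|].
             rewrite orb_false_r in h3. now rewrite h3.
          -- apply Nat.eqb_eq in h1. subst d'. rewrite Nat.eqb_refl. cbn [andb].
             apply hs. right. now exists k.
        * apply u_in in hk. destruct e as [j m|d' m|]; cbn [member] in hk |- *; [exact hk| |exact hk].
          apply andb_true_iff in hk. destruct hk as [-> hk]. cbn [andb]. apply hs. now left.
      + intro he. destruct e as [j m|d' m|]; [| |discriminate].
        * right. right. now apply u_onto.
        * cbn [member] in he. apply andb_true_iff in he. destruct he as [h1 h2].
          apply Nat.eqb_eq in h1. subst d'. apply hs in h2.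
          destruct h2 as [h2|h2]; [|now right; left].
          right. right. apply u_onto. cbn [member]. now rewrite Nat.eqb_refl, h2.
    (* Silence at [L d s'] requires [s'] to lie inside [s]. Before [c] no such program occurs, on
       the way to [T2 d] its elements have been presented, and afterwards [u_L] places them in
       [s0]. *)
    - intro k. unfold ans at 2. rewrite <- ei, <- ec. apply ans2_valid_L; [exact cv'|].
      intros s' es y hy. apply hs. fold start in es.
      destruct (le_lt_dec c k) as [lk|lk].
      + destruct (le_lt_dec (c + n) k) as [lk'|lk'].
        * left. replace k with (c + (n + (k - c - n))) in es by lia.
          rewrite tail in es. exact (u_L _ s' es y hy).
        * right. replace k with (c + (k - c)) in es by lia. unfold T in es.
          rewrite run_splice_r, hA1, run_splice_l, same in es by lia.
          exact (fL (k - c) s' y ltac:(lia) es hy).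
      + unfold T in es. rewrite run_splice_l in es by lia.
        now apply (proj2 (hA2 k lk)) in es.
    - exists s, N. split; [apply hs; right; exact fx|].
      intros k lk. rewrite <- tail. apply hN. lia. }
  (* A text for [L d 0], whose set is [{0}]; position [c] is filled with [X d 0] as [A i c] must not
     appear. All its data belong to every [L d s]. *)
  set (base := fun n => if n <? v then (if n =? c then Some (X d 0) else Some (A i n)) else Some (X d 0)).
  assert (base_in : forall s k e, base k = Some e -> member (L d s) e = true).
  { intros s k e. unfold base. assert (hX : member (L d s) (X d 0) = true) by (cbn; now rewrite Nat.eqb_refl).
    destruct (k <? v) eqn:lt; [|now intros [= <-]].
    destruct (k =? c) eqn:ek; intros [= <-]; [exact hX|].
    cbn [member]. fold v. now rewrite ei, ec, Nat.eqb_refl, lt, ek. }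
  (* Otherwise [u_L] would hold vacuously and [final] would force convergence to some [L d s], which
     is such a visit. *)
  assert (visit : exists k s, run E ans (T2 d) base k = L d s).
  { apply NNPP. intro no.
    destruct (final 0 base 0) as [s [N [_ hN]]].
    - apply base_in.
    - intros e he. destruct e as [j m|d' m|]; [| |discriminate]; cbn [member] in he.
      + apply andb_true_iff in he. destruct he as [h1 h2]. apply andb_true_iff in h2. destruct h2 as [h2 h3].
        apply Nat.eqb_eq in h1. subst j. fold v in h2. rewrite ec in h3. apply negb_true_iff in h3.
        exists m. unfold base. now rewrite h2, h3, ei.
      + apply andb_true_iff in he. destruct he as [h1 h2]. apply Nat.eqb_eq in h1. subst d'.
        rewrite in_set_zero in h2. apply Nat.eqb_eq in h2. subst m.
        exists v. unfold base. now rewrite Nat.ltb_irrefl.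
    - intros k s h. exfalso. apply no. now exists k, s.
    - apply no. exists N, s. now apply hN. }
  destruct (least_witness _ visit) as [k [[s hk] first]].
  (* From the first conjecture [L d s] on, only elements of [L d s] are presented, so the engine is
     locked there. Neither [k] nor [s] depends on [x]. *)
  set (u := splice k base (fun n => Some (if member (L d s) (elem_of n) then elem_of n else X d 0))).
  assert (stuck : forall n, run E ans (T2 d) u (k + n) = L d s).
  { intro n. unfold u. rewrite run_splice_r, hk.
    induction n as [|n IH]; [reflexivity|]. cbn [run]. rewrite IH.
    assert (ea : ans (L d s) = None) by (cbn; now rewrite Nat.eqb_refl).
    rewrite ea. apply advance_locked; [exact identifies | exact I|].
    destruct (member (L d s) (elem_of n)) eqn:em; [exact em|]. cbn. now rewrite Nat.eqb_refl. }
  (* Hence [x] may be chosen after [s]: [S s] exceeds all members of [s], yet it must belong to the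
     limit, which is [L d s]. *)
  destruct (final (S s) u s) as [s' [N [h hN]]].
  - intros n e. unfold u. intro hn.
    destruct (proj1 (splice_exists k base _ (Some e)) (ex_intro _ n hn)) as [[m [_ hm]]|[m hm]].
    + exact (base_in s m e hm).
    + destruct (member (L d s) (elem_of m)) eqn:em; injection hm as <-; [exact em|].
      cbn. now rewrite Nat.eqb_refl.
  - intros e he. apply splice_exists. right. exists (of_elem e). now rewrite elem_ofK, he.
  - intros n s' hn. destruct (le_lt_dec k n) as [l|l].
    + replace n with (k + (n - k)) in hn by lia. rewrite stuck in hn. now injection hn as <-.
    + unfold u in hn. rewrite run_splice_l in hn by lia. exfalso. apply (first n l). now exists s'.
  - specialize (hN (k + N) ltac:(lia)). rewrite stuck in hN. injection hN as <-.
    now rewrite in_set_succ_self in h.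
Qed.
End refutation.

(** The initial program equals at most one of [T1 0] and [T1 1], so one of the two serves as the
    fresh index. *)
Lemma probe_not_CEGIS : ~ CEGIS probe_family.
Proof.
  intros [E hE].
  destruct (classic (prog_of (P_init E) = T1 0)) as [e|ne].
  - apply (no_identification E hE 1). rewrite e. discriminate.
  - exact (no_identification E hE 0 ne).
Qed.

Theorem theorem2 :
  (exists LL : indexed_family, HCEGIS LL /\ ~ CEGIS LL) /\
  (exists LL : indexed_family, CEGIS LL /\ ~ HCEGIS LL).
Proof.
  split.
  - exists probe_family. split; [exact probe_HCEGIS | exact probe_not_CEGIS].
  - exists initial_segments. split; [exact initial_segments_CEGIS | exact initial_segments_not_HCEGIS].
Qed.
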